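(* Let $(A,\bullet_i,\Delta)$ be a grafting bialgebra. For $x\in A_n$, $y\in A_m$ and $\gamma\in Sh(n,m)$ with associated compositions $(n_1,\dots,n_r)$ of $n$ and $(m_1,\dots,m_{r+1})$ of $m$ (see context), define $x\bullet_\gamma y=\sum x^{n_1}_{(1)}\bullet_{m_1}\big(x^{n_2}_{(2)}\bullet_{m_1+m_2}\big(\cdots\big(x^{n_r}_{(r)}\bullet_{m_1+\dots+m_r}y\big)\cdots\big)\big)$, where $\sum x^{n_1}_{(1)}\otimes\dots\otimes x^{n_r}_{(r)}$ is the component in $A_{n_1}\otimes\dots\otimes A_{n_r}$ of the iterated coproduct $\Delta^{(r-1)}(x)$ ($\Delta^{(0)}=\mathrm{id}$). Then $(A,\bullet_\gamma,\Delta)$ is a shuffle bialgebra.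
   Context: Permutations $\sigma\in S_n$ are written as words $(\sigma(1),\dots,\sigma(n))$; $1_n$ is the identity, and $\sigma\cdot\tau$ denotes composition, $(\sigma\cdot\tau)(i)=\sigma(\tau(i))$. For $\sigma\in S_n$, $\tau\in S_m$, $\sigma\times\tau\in S_{n+m}$ is $(\sigma(1),\dots,\sigma(n),\tau(1)+n,\dots,\tau(m)+n)$. For nonnegative integers $n_1,\dots,n_r$ with sum $n$, $Sh(n_1,\dots,n_r)$ is the set of $\sigma\in S_n$ such that $\sigma^{-1}(n_1+\dots+n_{k-1}+1)<\dots<\sigma^{-1}(n_1+\dots+n_k)$ for every $k$. For $n,m\ge0$, $\epsilon_{n,m}=(n+1,\dots,n+m,1,\dots,n)\in Sh(n,m)$. Every $\gamma\in Sh(n,m)$ is uniquely the word $(n+1,\dots,n+m_1,\,1,\dots,n_1,\,n+m_1+1,\dots,n+m_1+m_2,\,n_1+1,\dots,n_1+n_2,\dots)$ alternating blocks of consecutive values from $\{n+1,\dots,n+m\}$ of lengths $m_1,\dots,m_{r+1}$ and from $\{1,\dots,n\}$ of lengths $n_1,\dots,n_r$, with $n_j\ge1$, $m_1,m_{r+1}\ge0$, $m_j\ge1$ for $2\le j\le r$. A preshuffle algebra is a graded vector space $A=\bigoplus_{n\ge0}A_n$ with linear maps $\bullet_i:A_n\otimes A_m\to A_{n+m}$ ($0\le i\le m$) such that $(x\bullet_iy)\bullet_jz=x\bullet_{i+j}(y\bullet_jz)$ for $0\le i\le|y|$, $0\le j\le|z|$. A grafting algebra additionally satisfies $x\bullet_i(y\bullet_jz)=y\bullet_{j+|x|}(x\bullet_iz)$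 for $0\le i<j\le|z|$. A preshuffle bialgebra is a preshuffle algebra with $A_0=0$ and a coassociative coproduct $\Delta$ with $\Delta(A_n)\subseteq\bigoplus_{i=1}^{n-1}A_i\otimes A_{n-i}$ (Sweedler notation $\Delta(z)=\sum z_{(1)}\otimes z_{(2)}$) such that for homogeneous $x,y$: (1) $\Delta(x\bullet_0y)=\sum x_{(1)}\otimes(x_{(2)}\bullet_0y)+x\otimes y+\sum(x\bullet_0y_{(1)})\otimes y_{(2)}$; (2) for $1\le i\le|y|-1$: $\Delta(x\bullet_iy)=\sum_{|y_{(1)}|\le i}y_{(1)}\otimes(x\bullet_{i-|y_{(1)}|}y_{(2)})+\sum_{|y_{(1)}|=i}(x_{(1)}\bullet_iy_{(1)})\otimes(x_{(2)}\bullet_0y_{(2)})+\sum_{|y_{(1)}|\ge i}(x\bullet_iy_{(1)})\otimes y_{(2)}$; (3) $\Delta(x\bullet_{|y|}y)=\sum y_{(1)}\otimes(x\bullet_{|y_{(2)}|}y_{(2)})+y\otimes x+\sum(x_{(1)}\bullet_{|y|}y)\otimes x_{(2)}$. A grafting bialgebra is a preshuffle bialgebra whose underlying preshuffle algebra is a grafting algebra. A shuffle algebra is a graded vector space $A=\bigoplus_{n\ge0}A_n$ over a field $K$ with linear maps $\bullet_\gamma:A_n\otimes A_m\to A_{n+m}$ for all $n,m\ge0$ and $\gamma\in Sh(n,m)$, such that for $x\in A_n$, $y\in A_m$, $z\in A_r$ one has $x\bullet_\gamma(y\bullet_\delta z)=(x\bullet_\sigma y)\bullet_\lambda z$ whenever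 $\gamma\in Sh(n,m+r)$, $\delta\in Sh(m,r)$, $\sigma\in Sh(n,m)$, $\lambda\in Sh(n+m,r)$ satisfy $(1_n\times\delta)\cdot\gamma=(\sigma\times1_r)\cdot\lambda$. Decomposition of shuffles: for $\gamma\in Sh(n,m)$ and $0\le r\le n+m$, put $n_1=|\gamma^{-1}(\{1,\dots,n\})\cap\{1,\dots,r\}|$ and $m_1=r-n_1$; there are unique $\gamma^r_{(1)}\in Sh(n_1,m_1)$ and $\gamma^{n+m-r}_{(2)}\in Sh(n-n_1,m-m_1)$ with $\gamma=(1_{n_1}\times\epsilon_{n-n_1,m_1}\times1_{m-m_1})\cdot(\gamma^r_{(1)}\times\gamma^{n+m-r}_{(2)})$. A shuffle bialgebra is a shuffle algebra $A$ with $A_0=0$ together with a coassociative coproduct $\Delta:A\to A\otimes A$ with $\Delta(A_n)\subseteq\bigoplus_{i=1}^{n-1}A_i\otimes A_{n-i}$, such that for $x\in A_n$, $y\in A_m$, $\gamma\in Sh(n,m)$: $\Delta(x\bullet_\gamma y)=\sum_{r=1}^{n+m-1}\sum(x_{(1)}\bullet_{\gamma^r_{(1)}}y_{(1)})\otimes(x_{(2)}\bullet_{\gamma^{n+m-r}_{(2)}}y_{(2)})$, where, with $\Delta_+(z)=z\otimes1+1\otimes z+\Delta(z)$ on $K1\oplus A$ ($1$ of degree $0$), the inner sum is over the homogeneous components $x_{(1)}\otimes x_{(2)}$ of $\Delta_+(x)$ with $|x_{(1)}|=n_1$ and $y_{(1)}\otimes y_{(2)}$ of $\Delta_+(y)$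 with $|y_{(1)}|=m_1$, using the conventions $1\bullet_\tau z=z\bullet_\tau1=z$. *)

(* Defs.v *)
From HB Require Import structures.
From mathcomp Require Import all_boot all_order all_algebra.
From Stdlib Require Import ClassicalEpsilon.

Set Implicit Arguments.
Unset Strict Implicit.
Unset Printing Implicit Defensive.
Import GRing.Theory.
Local Open Scope ring_scope.

(* Permutations as words (sigma(1),...,sigma(n)), values in 1..n.      *)

Definition idw (n : nat) : seq nat := iota 1 n.
Definition compw (s t : seq nat) : seq nat := [seq nth 0%N s j.-1 | j <- t].
Definition prodw (s t : seq nat) : seq nat := s ++ [seq (j + size s)%N | j <- t].
Definition epsw (n m : nat) : seq nat := iota n.+1 m ++ iota 1 n.

(* w in Sh(n,m): w is a permutation of 1..n+m with
   w^-1(1) < ... < w^-1(n) and w^-1(n+1) < ... < w^-1(n+m)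
   (positions: w^-1(a) = index a w + 1). *)
Definition is_shuffle (n m : nat) (w : seq nat) : Prop :=
  [/\ perm_eq w (iota 1 (n + m)),
      (forall a, (1 <= a)%N -> (a < n)%N -> (index a w < index a.+1 w)%N) &
      (forall a, (n < a)%N -> (a < n + m)%N -> (index a w < index a.+1 w)%N)].

Definition dec_n1 (n : nat) (g : seq nat) (r : nat) : nat :=
  count (fun v => (v <= n)%N) (take r g).

(* the unique (gamma^r_(1), gamma^{n+m-r}_(2)) *)
Definition shuffle_decomp (n m : nat) (g : seq nat) (r : nat) : seq nat * seq nat :=
  let n1 := dec_n1 n g r in
  let m1 := (r - n1)%N in
  epsilon (inhabits ([::], [::]))
    (fun p => [/\ is_shuffle n1 m1 p.1, is_shuffle (n - n1) (m - m1) p.2 &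
       g = compw (prodw (prodw (idw n1) (epsw (n - n1) m1)) (idw (m - m1)))
                 (prodw p.1 p.2)]).

(* the word (n+1..n+m_1, 1..n_1, n+m_1+1..n+m_1+m_2, n_1+1..n_1+n_2, ...) ;
   a = next value of {1..n}, b = next value of {n+1..n+m} *)
Fixpoint blocksw (a b : nat) (ns ms : seq nat) : seq nat :=
  match ns, ms with
  | n1 :: ns', m1 :: ms' => iota b m1 ++ iota a n1 ++ blocksw (a + n1) (b + m1) ns' ms'
  | [::], [:: m1] => iota b m1
  | _, _ => [::]
  end.

(* the unique compositions ((n_1..n_r), (m_1..m_{r+1})) associated to gamma *)
Definition shuffle_comps (n m : nat) (g : seq nat) : seq nat * seq nat :=
  epsilon (inhabits ([::], [::]))
    (fun p => [/\ size p.2 = (size p.1).+1, sumn p.1 = n, sumn p.2 = m &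
       [/\ all (fun k => 0 < k)%N p.1,
       (forall j, (0 < j)%N -> (j < size p.1)%N -> (0 < nth 0%N p.2 j)%N) &
       g = blocksw 1 n.+1 p.1 p.2]]).

(* Tensors: an element of A^{(x) r} is represented by a finite formal  *)
(* sum of pure tensors (a list of r-element lists); two such           *)
(* expressions are equal in A^{(x) r} iff every r-multilinear map out  *)
(* of A^r agrees on them (universal property of the tensor product).   *)

Section Tensor.
Variables (K : fieldType) (A : lmodType K).

Definition multilin (W : lmodType K) (r : nat) (f : seq A -> W) : Prop :=
  forall l1 l2 : seq A, ((size l1 + size l2).+1 = r)%N ->
  forall (k : K) (a b : A),
    f (l1 ++ (k *: a + b) :: l2) = k *: f (l1 ++ a :: l2) + f (l1 ++ b :: l2).

Definition teq (r : nat) (t t' : seq (seq A)) : Prop :=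
  forall (W : lmodType K) (f : seq A -> W), multilin r f ->
    \sum_(l <- t) f l = \sum_(l <- t') f l.

Definition teq2 (t t' : seq (A * A)) : Prop :=
  teq 2 [seq [:: p.1; p.2] | p <- t] [seq [:: p.1; p.2] | p <- t'].

End Tensor.

Section Graded.
Variables (K : fieldType) (A : lmodType K).
(* pr n = projection of A = (+)_n A_n onto A_n *)
Variable pr : nat -> A -> A.

Definition homog (n : nat) (x : A) : Prop := pr n x = x.

Definition graded : Prop :=
  [/\ (forall n (k : K) (a b : A), pr n (k *: a + b) = k *: pr n a + pr n b),
      (forall n x, pr n (pr n x) = pr n x),
      (forall n m x, n != m -> pr n (pr m x) = 0) &
      (forall x, exists N, x = \sum_(i < N) pr i x)].

Definition A0_trivial : Prop := forall x, pr 0 x = 0.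

Variable Delta : A -> seq (A * A).

(* homogeneous components of Delta x, x in A_n:  (|x_(1)|, (x_(1), x_(2))) *)
Definition hD (n : nat) (x : A) : seq (nat * (A * A)) :=
  flatten [seq [seq (k, (pr k p.1, pr (n - k) p.2)) | p <- Delta x] | k <- iota 1 n.-1].

Definition coproduct_ok : Prop :=
  [/\ (forall (k : K) (a b : A),
         teq2 (Delta (k *: a + b)) ([seq (k *: p.1, p.2) | p <- Delta a] ++ Delta b)),
      (forall x, teq 3
         (flatten [seq [seq [:: q.1; q.2; p.2] | q <- Delta p.1] | p <- Delta x])
         (flatten [seq [seq [:: p.1; q.1; q.2] | q <- Delta p.2] | p <- Delta x])) &
      (forall n x, homog n x -> exists t, teq2 (Delta x) t /\
         forall p, p \in t -> exists i, [/\ (0 < i)%N, (i < n)%N,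
                                           homog i p.1 & homog (n - i) p.2])].

Variable bop : nat -> A -> A -> A.

Definition bop_ok : Prop :=
  forall n m i, (i <= m)%N -> forall x y, homog n x -> homog m y ->
  [/\ homog (n + m) (bop i x y),
      (forall (k : K) x', homog n x' -> bop i (k *: x + x') y = k *: bop i x y + bop i x' y) &
      (forall (k : K) y', homog m y' -> bop i x (k *: y + y') = k *: bop i x y + bop i x y')].

Definition preshuffle_algebra : Prop :=
  bop_ok /\
  forall n m r i j x y z, homog n x -> homog m y -> homog r z ->
    (i <= m)%N -> (j <= r)%N -> bop j (bop i x y) z = bop (i + j) x (bop j y z).

Definition grafting_axiom : Prop :=
  forall n m r i j x y z, homog n x -> homog m y -> homog r z ->
    (i < j)%N -> (j <= r)%N -> bop i x (bop j y z) = bop (j + n) y (bop i x z).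

Definition preshuffle_compat : Prop :=
  forall n m x y, homog n x -> homog m y ->
  [/\ teq2 (Delta (bop 0 x y))
        ([seq (q.2.1, bop 0 q.2.2 y) | q <- hD n x] ++ (x, y) ::
         [seq (bop 0 x q.2.1, q.2.2) | q <- hD m y]),
      (forall i, (1 <= i)%N -> (i <= m.-1)%N ->
        teq2 (Delta (bop i x y))
          ([seq (q.2.1, bop (i - q.1) x q.2.2) | q <- hD m y & (q.1 <= i)%N] ++
           flatten [seq [seq (bop i p.2.1 q.2.1, bop 0 p.2.2 q.2.2)
                          | q <- hD m y & q.1 == i] | p <- hD n x] ++
           [seq (bop i x q.2.1, q.2.2) | q <- hD m y & (i <= q.1)%N])) &
      teq2 (Delta (bop m x y))
        ([seq (q.2.1, bop (m - q.1) x q.2.2) | q <- hD m y] ++ (y, x) ::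
         [seq (bop m p.2.1 y, p.2.2) | p <- hD n x])].

Definition preshuffle_bialgebra : Prop :=
  [/\ preshuffle_algebra, A0_trivial, coproduct_ok & preshuffle_compat].

Definition grafting_bialgebra : Prop := preshuffle_bialgebra /\ grafting_axiom.

Fixpoint nest (l : seq A) (ms : seq nat) (acc : nat) (y : A) : A :=
  match l, ms with
  | a :: l', mk :: ms' => bop (acc + mk) a (nest l' ms' (acc + mk) y)
  | _, _ => y
  end.

Fixpoint iterD (k : nat) (x : A) : seq (seq A) :=
  match k with
  | 0 => [:: [:: x]]
  | k'.+1 => flatten [seq [seq p.1 :: l | l <- iterD k' p.2] | p <- Delta x]
  end.

Definition graft_sop (n m : nat) (g : seq nat) (x y : A) : A :=
  let c := shuffle_comps n m g in
  if c.1 is [::] then 0 (* only n = 0, where x in A_0 = 0 *)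
  else \sum_(l <- iterD (size c.1).-1 x) nest [seq pr q.1 q.2 | q <- zip c.1 l] c.2 0 y.

End Graded.

Section Shuffle.
Variables (K : fieldType) (A : lmodType K).
Variable pr : nat -> A -> A.
Variable Delta : A -> seq (A * A).
Variable sop : nat -> nat -> seq nat -> A -> A -> A.

Definition sop_ok : Prop :=
  forall n m g, is_shuffle n m g -> forall x y, homog pr n x -> homog pr m y ->
  [/\ homog pr (n + m) (sop n m g x y),
      (forall (k : K) x', homog pr n x' ->
         sop n m g (k *: x + x') y = k *: sop n m g x y + sop n m g x' y) &
      (forall (k : K) y', homog pr m y' ->
         sop n m g x (k *: y + y') = k *: sop n m g x y + sop n m g x y')].

Definition shuffle_algebra : Prop :=
  sop_ok /\
  forall n m r g d s l x y z, homog pr n x -> homog pr m y -> homog pr r z ->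
    is_shuffle n (m + r) g -> is_shuffle m r d -> is_shuffle n m s ->
    is_shuffle (n + m) r l ->
    compw (prodw (idw n) d) g = compw (prodw s (idw r)) l ->
    sop n (m + r) g x (sop m r d y z) = sop (n + m) r l (sop n m s x y) z.

(* homogeneous component of Delta_+(x) = x (x) 1 + 1 (x) x + Delta x (x in A_n)
   with |x_(1)| = k;  None stands for the unit 1 of degree 0 *)
Definition DPlus (n k : nat) (x : A) : seq (option A * option A) :=
  if k == 0%N then [:: (None, Some x)]
  else if k == n then [:: (Some x, None)]
  else [seq (Some q.2.1, Some q.2.2) | q <- hD pr Delta n x & q.1 == k].

Definition uop (n m : nat) (g : seq nat) (u v : option A) : A :=
  match u, v with
  | Some a, Some b => sop n m g a b
  | Some a, None => a
  | None, Some b => b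
  | None, None => 0
  end.

Definition shuffle_compat : Prop :=
  forall n m g x y, is_shuffle n m g -> homog pr n x -> homog pr m y ->
  teq2 (Delta (sop n m g x y))
    (flatten [seq
       (let n1 := dec_n1 n g r in
        let m1 := (r - n1)%N in
        let gs := shuffle_decomp n m g r in
        flatten [seq [seq (uop n1 m1 gs.1 u.1 v.1, uop (n - n1) (m - m1) gs.2 u.2 v.2)
                      | v <- DPlus m m1 y] | u <- DPlus n n1 x])
     | r <- iota 1 (n + m).-1]).

Definition shuffle_bialgebra : Prop :=
  [/\ shuffle_algebra, A0_trivial pr, coproduct_ok pr Delta & shuffle_compat].

End Shuffle.

(* Main.v *)
Require Import Defs.
From mathcomp Require Import all_boot all_order all_algebra.
From mathcomp Require Import zify.
From Stdlib Require Import ClassicalEpsilon.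

(* Adjoin to A a unit of degree 0, so that Delta becomes counital and all
   boundary cases of the compatibility axioms merge into three uniform rules.
   Writing L_i(x) for y |-> x •_i y, the product x •_gamma y is then a
   convolution product of the operators L_0, L_1, ..., L_m restricted to the
   numbers of x's standing in the m + 1 gaps between the y's; empty gaps are
   harmless because of the counit.  Compatibility with Delta follows by cutting
   the word of gamma at any letter and using coassociativity.  Associativity is
   proved by cutting the three-letter word of (x, y, z) at the first z: the
   preshuffle axiom turns L_k(x •_sigma y) into a product of operators in x and
   y, and the grafting axiom moves the operators in y to the right past those
   in x. *)

Set Implicit Arguments.
Unset Strict Implicit.
Unset Printing Implicit Defensive.
Import GRing.Theory.
Local Open Scope ring_scope.

(** * Graded multilinear calculus *)

Section Multilinear.
Variables (K : fieldType) (B : lmodType K) (H : nat -> B -> Prop).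
Variable D : nat -> nat -> B -> seq (B * B).

(** Products are specified only on homogeneous arguments, with an index bounded by the degree of the
    right factor, and tensors are formal sums compared through multilinear maps. Coproduct
    identities are therefore equalities of Sweedler sums against an arbitrary function that is
    bilinear on the relevant bidegree, and homogeneity has to be carried through every step. The
    compositions of gamma behave badly under the operations of the proof: cutting the word breaks
    runs, and deleting the letters of one kind makes runs join. The list of all gaps, empty ones
    included, is better behaved: at a cut only the gap that contains it is shared by the two halves.
    The first z is the right place to cut because the grafting axiom needs a strict inequality
    between its indices: the x's after that z act strictly beyond the index at which the y's before
    it are inserted. *)

Definition linear_on (W : lmodType K) n (g : B -> W) :=
  forall c x x', H n x -> H n x' -> g (c *: x + x') = c *: g x + g x'.

Definition bilinear_on (W : lmodType K) k l (f : B -> B -> W) :=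
  (forall y, H l y -> linear_on k (f^~ y)) /\
  (forall x, H k x -> linear_on l (f x)).

Definition trilinear_on (W : lmodType K) k l m (f : B -> B -> B -> W) :=
  [/\ forall y z, H l y -> H m z -> linear_on k (fun x => f x y z),
      forall x z, H k x -> H m z -> linear_on l (fun y => f x y z) &
      forall x y, H k x -> H l y -> linear_on m (f x y)].

(* Sweedler sum of f over the component of degree (k, l) of the coproduct of
   x; identities between tensors are expressed through such sums. *)
Definition sw (W : lmodType K) k l (f : B -> B -> W) (x : B) : W :=
  \sum_(p <- D k l x) f p.1 p.2.

End Multilinear.

(** All that the convolution calculus uses. [D k l] lists the component of the coproduct in bidegree
    [(k, l)], with 0 allowed on either side. The three compatibility rules say where a cut of
    [b i x y] falls: in y before the inserted x, inside x, or in y after it. They overlap at the two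
    ends of x. *)
Record unital_grafting (K : fieldType) (B : lmodType K) (H : nat -> B -> Prop)
  (e : B) (b : nat -> B -> B -> B) (D : nat -> nat -> B -> seq (B * B)) : Prop :=
  UnitalGrafting {
  ug_zero : forall n, H n 0;
  ug_lin : forall n c x y, H n x -> H n y -> H n (c *: x + y);
  ug_one : H 0%N e;
  ug_bH : forall n m i x y, (i <= m)%N -> H n x -> H m y -> H (n + m)%N (b i x y);
  ug_bbil : forall n m i, (i <= m)%N -> bilinear_on H n m (b i);
  ug_1b : forall m i y, (i <= m)%N -> H m y -> b i e y = y;
  ug_b1 : forall n x, H n x -> b 0 x e = x;
  ug_assoc : forall n m r i j x y z, (i <= m)%N -> (j <= r)%N ->
    H n x -> H m y -> H r z -> b j (b i x y) z = b (i + j)%N x (b j y z);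
  ug_graft : forall n m r i j x y z, (i < j)%N -> (j <= r)%N ->
    H n x -> H m y -> H r z -> b i x (b j y z) = b (j + n)%N y (b i x z);
  ug_DH : forall k l x p, H (k + l)%N x -> p \in D k l x -> H k p.1 /\ H l p.2;
  ug_swlin : forall (W : lmodType K) k l (f : B -> B -> W),
    bilinear_on H k l f -> linear_on H (k + l) (sw D k l f);
  ug_coassoc : forall (W : lmodType K) k l m (f : B -> B -> B -> W) x,
    trilinear_on H k l m f -> H (k + l + m)%N x ->
    sw D (k + l) m (fun u w => sw D k l (fun p q => f p q w) u) x =
    sw D k (l + m) (fun p v => sw D l m (f p) v) x;
  ug_counitl : forall (W : lmodType K) n (f : B -> B -> W) x,
    bilinear_on H 0 n f -> H n x -> sw D 0 n f x = f e x;
  ug_counitr : forall (W : lmodType K) n (f : B -> B -> W) x,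
    bilinear_on H n 0 f -> H n x -> sw D n 0 f x = f x e;
  ug_compat_left : forall (W : lmodType K) n k m i (f : B -> B -> W) x y,
    (i <= m)%N -> H n x -> H (k + m)%N y -> bilinear_on H k (n + m) f ->
    sw D k (n + m) f (b (k + i)%N x y) = sw D k m (fun p q => f p (b i x q)) y;
  ug_compat_mid : forall (W : lmodType K) k l i m (f : B -> B -> W) x y,
    H (k + l)%N x -> H (i + m)%N y -> bilinear_on H (k + i) (l + m) f ->
    sw D (k + i) (l + m) f (b i x y) =
    sw D k l (fun p q => sw D i m (fun p' q' => f (b i p p') (b 0 q q')) y) x;
  ug_compat_right : forall (W : lmodType K) n k m i (f : B -> B -> W) x y,
    (i <= k)%N -> H n x -> H (k + m)%N y -> bilinear_on H (n + k) m f ->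
    sw D (n + k) m f (b i x y) = sw D k m (fun p q => f (b i x p) q) y
}.

(** * Convolution products of insertion operators *)

Section Convolution.
Variables (K : fieldType) (B : lmodType K) (H : nat -> B -> Prop) (e : B).
Variables (b : nat -> B -> B -> B) (D : nat -> nat -> B -> seq (B * B)).
Hypothesis ug : unital_grafting H e b D.

Local Notation linear_on := (linear_on H).
Local Notation bilinear_on := (bilinear_on H).
Local Notation sw := (sw D).

Lemma linear_on0 (W : lmodType K) n (g : B -> W) : linear_on n g -> g 0 = 0.
Proof.
move=> gl; have := gl 1 0 0 (ug_zero ug n) (ug_zero ug n).
rewrite !scale1r addr0 => h; apply: (addrI (g 0)).
by rewrite -h addr0.
Qed.

Lemma homD n x y : H n x -> H n y -> H n (x + y).
Proof. by move=> Hx Hy; rewrite -[x]scale1r; apply: (ug_lin ug). Qed.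

Lemma linear_onD (W : lmodType K) n (g : B -> W) x y :
  linear_on n g -> H n x -> H n y -> g (x + y) = g x + g y.
Proof. by move=> gl Hx Hy; have := gl 1 _ _ Hx Hy; rewrite !scale1r. Qed.

Lemma linear_on_comp (W : lmodType K) n m (h : B -> B) (g : B -> W) :
  linear_on m g -> linear_on n h -> (forall x, H n x -> H m (h x)) ->
  linear_on n (fun x => g (h x)).
Proof. by move=> gl hl Hh c x x' Hx Hx'; rewrite hl // gl //; apply: Hh. Qed.

Lemma hom_sum n (T : eqType) (s : seq T) (F : T -> B) :
  (forall p, p \in s -> H n (F p)) -> H n (\sum_(p <- s) F p).
Proof.
move=> HF; rewrite big_seq; apply: (big_ind (H n)) => // [|x y].
  exact: (ug_zero ug).
exact: homD.
Qed.

Lemma linear_on_sum (W : lmodType K) n (g : B -> W) (T : eqType) (s : seq T)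
    (F : T -> B) : linear_on n g -> (forall p, p \in s -> H n (F p)) ->
  g (\sum_(p <- s) F p) = \sum_(p <- s) g (F p).
Proof.
move=> gl; elim: s => [|p s IHs] HF; first by rewrite !big_nil (linear_on0 gl).
rewrite !big_cons -IHs => [|q qs]; last by apply: HF; rewrite in_cons qs orbT.
apply: (linear_onD gl); first by apply: HF; rewrite mem_head.
by apply: hom_sum => q qs; apply: HF; rewrite in_cons qs orbT.
Qed.

Lemma sw_ext (W : lmodType K) k l (f g : B -> B -> W) x : H (k + l)%N x ->
  (forall u v, H k u -> H l v -> f u v = g u v) -> sw k l f x = sw k l g x.
Proof. by move=> Hx fg; apply: eq_big_seq => p /(ug_DH ug Hx) []; apply: fg. Qed.

Lemma hom_sw n k l (f : B -> B -> B) x : H (k + l)%N x ->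
  (forall u v, H k u -> H l v -> H n (f u v)) -> H n (sw k l f x).
Proof. by move=> Hx Hf; apply: hom_sum => p /(ug_DH ug Hx) []; apply: Hf. Qed.

Lemma sw_push (W : lmodType K) n k l (f : B -> B -> B) (g : B -> W) x :
  H (k + l)%N x -> linear_on n g ->
  (forall u v, H k u -> H l v -> H n (f u v)) ->
  g (sw k l f x) = sw k l (fun u v => g (f u v)) x.
Proof.
move=> Hx gl Hf; apply: (linear_on_sum gl) => p /(ug_DH ug Hx) [].
exact: Hf.
Qed.

Lemma sw_exchange (W : lmodType K) k l k' l' (F : B -> B -> B -> B -> W) x y :
  sw k l (fun u v => sw k' l' (F u v) y) x =
  sw k' l' (fun p q => sw k l (fun u v => F u v p q) x) y.
Proof. exact: exchange_big. Qed.

Lemma linear_on_swr (W : lmodType K) n k l (F : B -> B -> B -> W) y :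
  H (k + l)%N y ->
  (forall u v, H k u -> H l v -> linear_on n (fun x => F x u v)) ->
  linear_on n (fun x => sw k l (F x) y).
Proof.
move=> Hy Fl c x x' Hx Hx'; rewrite /sw scaler_sumr -big_split /=.
by apply: eq_big_seq => p /(ug_DH ug Hy) [Hu Hv]; rewrite Fl.
Qed.

Lemma hom_b n m i x y : (i <= m)%N -> H n x -> H m y -> H (n + m)%N (b i x y).
Proof. exact: (ug_bH ug). Qed.

Lemma linear_on_bl n m i y : (i <= m)%N -> H m y -> linear_on n (b i ^~ y).
Proof. by move=> im; apply: (ug_bbil ug n im).1. Qed.

Lemma linear_on_br n m i x : (i <= m)%N -> H n x -> linear_on m (b i x).
Proof. by move=> im; apply: (ug_bbil ug n im).2. Qed.

(* Degree 0 is spanned by the unit, so there the index is irrelevant. *)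
Lemma b_deg0 m i x y : (i <= m)%N -> H 0 x -> H m y -> b i x y = b 0 x y.
Proof.
move=> im Hx Hy.
(* The two counit laws evaluate the same sum [sw 0 0 f x], once as [f e x], which is [b 0 x y], and
   once as [f x e], which is [b i x y]. *)
pose f u v := b i u (b 0 v y).
have bf : bilinear_on 0 0 f.
  split=> z Hz.
    by apply: (@linear_on_bl _ m) => //; apply: (hom_b (n := 0)).
  apply: (linear_on_comp (g := b i z)).
  - exact: (@linear_on_br 0 m).
  - exact: (@linear_on_bl _ m).
  - by move=> x' Hx'; apply: (hom_b (n := 0)).
have := ug_counitl ug bf Hx; rewrite (ug_counitr ug bf Hx) /f.
rewrite (ug_1b ug (m := m)) // (ug_1b ug (m := m)) //.
exact: (hom_b (n := 0)).
Qed.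

Definition deg (s : seq (nat * nat)) := sumn (unzip2 s).
Definition idx_le m (s : seq (nat * nat)) := all (fun p => p.1 <= m)%N s.
Definition idx_shift i (s : seq (nat * nat)) := [seq (i + p.1, p.2)%N | p <- s].

Lemma idx_le_cons m i k s : idx_le m ((i, k) :: s) = (i <= m)%N && idx_le m s.
Proof. by []. Qed.

Lemma idx_le_cat m s1 s2 : idx_le m (s1 ++ s2) = idx_le m s1 && idx_le m s2.
Proof. exact: all_cat. Qed.

Lemma deg_cons i k s : deg ((i, k) :: s) = (k + deg s)%N.
Proof. by []. Qed.

Lemma deg_cat s1 s2 : deg (s1 ++ s2) = (deg s1 + deg s2)%N.
Proof. by rewrite /deg /unzip2 map_cat sumn_cat. Qed.

Lemma deg_shift i s : deg (idx_shift i s) = deg s.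
Proof. by rewrite /deg /unzip2 -map_comp; congr sumn; apply: eq_map. Qed.

Lemma idx_leW m m' s : (m <= m')%N -> idx_le m s -> idx_le m' s.
Proof. by move=> mm'; apply: sub_all => p /= h; apply: leq_trans mm'. Qed.

Lemma idx_le_shift i m s : idx_le (i + m) (idx_shift i s) = idx_le m s.
Proof. by rewrite /idx_le all_map; apply: eq_all => p /=; rewrite leq_add2l. Qed.

(* With L_i(x) = b i x, [conv s] is the convolution product of the L_i
   restricted to degree k, over the pairs (i, k) of s. *)
Fixpoint conv (s : seq (nat * nat)) (x y : B) : B :=
  if s is (i, k) :: s' then sw k (deg s') (fun u v => b i u (conv s' v y)) x
  else b 0 x y.

(** Degree and bilinearity share one induction: [b i u] is linear only on homogeneous arguments, so
    the inner convolution must already be known to be homogeneous. *)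
Lemma conv_spec m s : idx_le m s ->
  (forall x y, H (deg s) x -> H m y -> H (deg s + m)%N (conv s x y)) /\
  bilinear_on (deg s) m (conv s).
Proof.
elim: s => [|[i k] s IHs] /= => [_|/andP[im /IHs[IHH [IHl IHr]]]].
  split=> [x y Hx Hy|]; [exact: (hom_b (n := 0)) | exact: (ug_bbil ug 0)].
have ims : (i <= deg s + m)%N by apply: leq_trans im _; apply: leq_addl.
have Hin u v y : H m y -> H k u -> H (deg s) v ->
    H (k + (deg s + m))%N (b i u (conv s v y)).
  by move=> Hy Hu Hv; apply: hom_b => //; apply: IHH.
have bil y : H m y -> bilinear_on k (deg s) (fun u v => b i u (conv s v y)).
  move=> Hy; split=> z Hz.
    by apply: (linear_on_bl ims); apply: IHH.
  apply: (linear_on_comp (linear_on_br ims Hz)); first exact: IHl.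
  by move=> v Hv; apply: IHH.
split=> [x y Hx Hy|].
  by rewrite -addnA; apply: (hom_sw Hx) => u v; apply: Hin.
split=> [y Hy|x Hx]; first exact: (ug_swlin ug (bil y Hy)).
apply: (linear_on_swr Hx) => u v Hu Hv.
apply: (linear_on_comp (linear_on_br ims Hu)); first exact: IHr.
by move=> y Hy; apply: IHH.
Qed.

Lemma hom_conv m s x y : idx_le m s -> H (deg s) x -> H m y ->
  H (deg s + m)%N (conv s x y).
Proof. by move=> /conv_spec[h _]; apply: h. Qed.

Lemma conv_bil m s : idx_le m s -> bilinear_on (deg s) m (conv s).
Proof. by case/conv_spec. Qed.

Lemma linear_on_convl m s y : idx_le m s -> H m y ->
  linear_on (deg s) (conv s ^~ y).
Proof. by move=> /conv_spec[_ [h _]]; apply: h. Qed.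

Lemma linear_on_convr m s x : idx_le m s -> H (deg s) x -> linear_on m (conv s x).
Proof. by move=> /conv_spec[_ [_ h]]; apply: h. Qed.

Lemma bil_b_conv i k m s y : idx_le m s -> (i <= deg s + m)%N -> H m y ->
  bilinear_on k (deg s) (fun u v => b i u (conv s v y)).
Proof.
move=> sm im Hy; split=> z Hz.
  by apply: (linear_on_bl im); apply: hom_conv.
apply: (linear_on_comp (linear_on_br im Hz)); first exact: linear_on_convl Hy.
by move=> v Hv; apply: hom_conv.
Qed.

Lemma conv1 i k x y m : (i <= m)%N -> H k x -> H m y -> conv [:: (i, k)] x y = b i x y.
Proof.
move=> im Hx Hy /=; rewrite (ug_counitr ug) //.
  by rewrite (ug_1b ug _ Hy).
by apply: (@bil_b_conv i k m [::]).
Qed.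

Lemma hom_conv2 m s1 s2 x y z : idx_le m s1 -> idx_le m s2 ->
  H (deg s1) x -> H (deg s2) y -> H m z ->
  H (deg s1 + (deg s2 + m))%N (conv s1 x (conv s2 y z)).
Proof.
move=> s1m s2m Hx Hy Hz; apply: hom_conv => //; last exact: hom_conv.
by apply: idx_leW s1m; apply: leq_addl.
Qed.

(** Associativity of the convolution product: coassociativity regroups the iterated Sweedler sum
    into the part used by [s1] and the part used by [s2]. *)
Lemma conv_cat m s1 s2 x y : idx_le m s1 -> idx_le m s2 ->
  H (deg s1 + deg s2)%N x -> H m y ->
  conv (s1 ++ s2) x y = sw (deg s1) (deg s2) (fun u v => conv s1 u (conv s2 v y)) x.
Proof.
move=> s1m s2m Hx Hy; elim: s1 s1m x Hx => [|[i k] s1 IHs] s1m x Hx.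
  rewrite cat0s (ug_counitl ug) //=.
    by rewrite (ug_1b ug (m := deg s2 + m)) //; apply: hom_conv.
  exact: (@bil_b_conv 0 0 m).
case/andP: s1m => im s1m.
have imr s : (i <= deg s + m)%N by apply: leq_trans im _; apply: leq_addl.
rewrite /= deg_cat.
have s1m' : idx_le (deg s2 + m) s1 by apply: idx_leW s1m; apply: leq_addl.
have im2 : (i <= deg s1 + (deg s2 + m))%N by rewrite addnA -deg_cat.
have Hx' : H (k + (deg s1 + deg s2))%N x by rewrite addnA.
transitivity (sw k (deg s1 + deg s2) (fun u v => sw (deg s1) (deg s2)
    (fun p q => b i u (conv s1 p (conv s2 q y))) v) x).
  apply: (sw_ext Hx') => u v Hu Hv; rewrite IHs // (sw_push (n := deg s1 + (deg s2 + m)) Hv) //.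
  - exact: linear_on_br Hu.
  - by move=> p q Hp Hq; exact: hom_conv2.
rewrite -(ug_coassoc ug (f := fun u p q => b i u (conv s1 p (conv s2 q y)))) //.
split=> z z' Hz Hz'.
- apply: (linear_on_bl im2); exact: hom_conv2.
- apply: (linear_on_comp (linear_on_br im2 Hz)).
    by apply: (linear_on_convl s1m'); apply: hom_conv.
  by move=> p Hp; exact: hom_conv2.
- apply: (linear_on_comp (linear_on_br im2 Hz)).
    apply: (linear_on_comp (linear_on_convr s1m' Hz')); first exact: linear_on_convl Hy.
    by move=> v Hv; apply: hom_conv.
  by move=> p Hp; exact: hom_conv2.
Qed.

Lemma conv_zero m s1 i s2 x y : idx_le m s1 -> idx_le m s2 -> (i <= m)%N ->
  H (deg s1 + deg s2)%N x -> H m y ->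
  conv (s1 ++ (i, 0%N) :: s2) x y = conv (s1 ++ s2) x y.
Proof.
move=> s1m s2m im Hx Hy.
have is2m : idx_le m ((i, 0%N) :: s2) by rewrite /= im.
rewrite !(conv_cat (m := m)) //.
apply: (sw_ext Hx) => u v Hu Hv.
congr (conv _ _ _); rewrite /= (ug_counitl ug) //.
  rewrite (ug_1b ug (m := deg s2 + m)) //; last exact: hom_conv.
  by apply: leq_trans im _; apply: leq_addl.
by apply: (@bil_b_conv i 0 m) => //; apply: leq_trans im _; apply: leq_addl.
Qed.

Lemma conv_deg0 m s x y : idx_le m s -> deg s = 0 -> H 0 x -> H m y ->
  conv s x y = b 0 x y.
Proof.
move=> + + Hx Hy; elim: s => [|[i k] s IHs] //= /andP[im sm].
rewrite /deg /= => /eqP; rewrite addn_eq0 => /andP[/eqP k0 /eqP s0].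
rewrite -IHs // {IHs} k0.
by apply: (conv_zero (m := m) (s1 := [::])) => //; rewrite /deg /= s0.
Qed.

(** Every insertion takes place at or beyond the cut after [i] letters of y, so no part of x reaches
    the left tensor factor. The proof applies [ug_compat_left] block by block. *)
Lemma sw_conv_shift (W : lmodType K) i m s (f : B -> B -> W) x y :
  idx_le m s -> H (deg s) x -> H (i + m)%N y -> bilinear_on i (deg s + m) f ->
  sw i (deg s + m) f (conv (idx_shift i s) x y) =
  sw i m (fun u v => f u (conv s x v)) y.
Proof.
move=> + + Hy; elim: s W f x => [|[j k] s IHs] W f x.
  move=> _ Hx fb; rewrite /= -(b_deg0 (leq_addr m i) Hx Hy).
  by have := ug_compat_left ug (leq0n m) Hx Hy fb; rewrite addn0.
move=> /andP[/= jm sm] Hx fb.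
have sim : idx_le (i + m) (idx_shift i s) by rewrite idx_le_shift.
have jsm : (j <= deg s + m)%N by apply: leq_trans jm _; apply: leq_addl.
have ijm : (i + j <= deg s + (i + m))%N by lia.
rewrite [LHS]/= deg_shift.
have Hc v : H (deg s) v -> H (i + (deg s + m))%N (conv (idx_shift i s) v y).
  rewrite addnCA => Hv; rewrite -{1}(deg_shift i); apply: hom_conv => //.
  by rewrite deg_shift.
have -> : (k + deg s + m = k + (deg s + m))%N by rewrite addnA.
rewrite (sw_push (n := i + (k + (deg s + m))) Hx); first last.
- move=> u v Hu Hv; rewrite addnCA; apply: hom_b => //; last exact: Hc.
  by rewrite leq_add2l.
- by apply: (ug_swlin ug); rewrite addnA.
transitivity (sw k (deg s) (fun u v => sw i m (fun p q =>
    f p (b j u (conv s v q))) y) x).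
  apply: (sw_ext Hx) => u v Hu Hv.
  rewrite (ug_compat_left ug (m := deg s + m)) //; last by rewrite addnA.
    apply: IHs => //; split=> z Hz.
      by apply: fb.1; rewrite -addnA; apply: hom_b.
    apply: (linear_on_comp (fb.2 _ Hz)); first exact: linear_on_br Hu.
    by move=> w Hw; rewrite -addnA; apply: hom_b.
  exact: Hc.
rewrite sw_exchange; apply: (sw_ext Hy) => u v Hu Hv.
rewrite (sw_push (n := k + (deg s + m)) Hx) //.
  by rewrite addnA; apply: fb.2.
by move=> p q Hp Hq; apply: hom_b => //; apply: hom_conv.
Qed.

(** The cut splits the first block into [a] and [c] letters: [ug_compat_mid] handles this block,
    [sw_conv_shift] the later ones. Coassociativity then joins the [c] letters to the rest of x; on
    the right they act at index 0, since the first [i] letters of y are gone. *)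
Lemma sw_conv_cut0 (W : lmodType K) i a c s m (f : B -> B -> W) x y :
  idx_le m s -> H (a + (c + deg s))%N x -> H (i + m)%N y ->
  bilinear_on (a + i) (c + deg s + m) f ->
  sw (a + i) (c + deg s + m) f (conv ((i, a + c)%N :: idx_shift i s) x y) =
  sw a (c + deg s) (fun p q => sw i m (fun p' q' =>
    f (b i p p') (conv ((0, c)%N :: s) q q')) y) x.
Proof.
move=> sm Hx Hy fb; rewrite [conv (_ :: idx_shift _ _) x y]/= deg_shift.
have sim : idx_le (i + m) (idx_shift i s) by rewrite idx_le_shift.
have iDm : (i <= deg s + (i + m))%N by lia.
have Hc v : H (deg s) v -> H (i + (deg s + m))%N (conv (idx_shift i s) v y).
  rewrite addnCA => Hv; rewrite -{1}(deg_shift i); apply: hom_conv => //.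
  by rewrite deg_shift.
have Hx' : H (a + c + deg s)%N x by rewrite -addnA.
have E : (a + i + (c + deg s + m) = a + c + (deg s + (i + m)))%N by lia.
rewrite (sw_push (n := a + i + (c + deg s + m)) Hx'); first last.
- move=> u v Hu Hv; rewrite E; apply: hom_b => //.
  by rewrite addnCA; apply: Hc.
- exact: (ug_swlin ug).
have fbl p p' : H a p -> H i p' -> H (a + i)%N (b i p p').
  by move=> Hp Hp'; apply: hom_b.
have fbr q v q' : H c q -> H (deg s) v -> H m q' ->
    H (c + deg s + m)%N (b 0 q (conv s v q')).
  by move=> Hq Hv Hq'; rewrite -addnA; apply: hom_b => //; apply: hom_conv.
transitivity (sw (a + c) (deg s) (fun u v => sw a c (fun p q => sw i m
    (fun p' q' => f (b i p p') (b 0 q (conv s v q'))) y) u) x).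
  apply: (sw_ext Hx') => u v Hu Hv; rewrite -addnA.
  rewrite (ug_compat_mid ug) //; [|exact: Hc|by rewrite addnA].
  apply: (sw_ext Hu) => p q Hp Hq; apply: sw_conv_shift => //; split=> z Hz.
    have Hz' : H (c + deg s + m)%N (b 0 q z) by rewrite -addnA; apply: hom_b.
    apply: (linear_on_comp (fb.1 _ Hz')) => [|p' Hp']; last exact: fbl.
    exact: linear_on_br Hp.
  apply: (linear_on_comp (fb.2 _ (fbl _ _ Hp Hz))); first exact: linear_on_br Hq.
  by move=> w Hw; rewrite -addnA; apply: hom_b.
rewrite (ug_coassoc ug (f := fun p q v => sw i m (fun p' q' =>
    f (b i p p') (b 0 q (conv s v q'))) y)) //.
  apply: (sw_ext Hx) => p q Hp Hq; rewrite sw_exchange.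
  apply: (sw_ext Hy) => p' q' Hp' Hq'.
  rewrite [conv _ q q']/= (sw_push (n := c + deg s + m) Hq) //.
    by apply: fb.2; apply: fbl.
  by move=> u v Hu Hv; apply: fbr.
split=> z z' Hz Hz'; apply: (linear_on_swr Hy) => p' q' Hp' Hq'.
- apply: (linear_on_comp (fb.1 _ (fbr _ _ _ Hz Hz' Hq'))) => [|p Hp]; last exact: fbl.
  exact: linear_on_bl Hp'.
- apply: (linear_on_comp (fb.2 _ (fbl _ _ Hz Hp'))) => [|q Hq]; last exact: fbr.
  by apply: (linear_on_bl (leq0n (deg s + m))); apply: hom_conv.
- apply: (linear_on_comp (fb.2 _ (fbl _ _ Hz Hp'))) => [|v Hv]; last exact: fbr.
  apply: (linear_on_comp (linear_on_br (leq0n (deg s + m)) Hz')).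
    exact: linear_on_convl Hq'.
  by move=> v Hv; apply: hom_conv.
Qed.

(** The blocks of [s1] insert left of the cut and are peeled off one at a time by [ug_compat_right];
    the block through which the cut passes, and all that follows it, is the case of
    [sw_conv_cut0]. *)
Lemma sw_conv_cut (W : lmodType K) s1 i a c s2 m (f : B -> B -> W) x y :
  idx_le i s1 -> idx_le m s2 -> H (deg s1 + a + (c + deg s2))%N x ->
  H (i + m)%N y -> bilinear_on (deg s1 + a + i) (c + deg s2 + m) f ->
  sw (deg s1 + a + i) (c + deg s2 + m) f
    (conv (s1 ++ (i, a + c)%N :: idx_shift i s2) x y) =
  sw (deg s1 + a) (c + deg s2) (fun p q => sw i m (fun p' q' =>
    f (conv (s1 ++ [:: (i, a)]) p p') (conv ((0, c)%N :: s2) q q')) y) x.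
Proof.
move=> + s2m + Hy; elim: s1 W f x => [|[j k] s1 IHs] W f x.
  move=> _; rewrite (erefl : deg [::] = 0%N) !add0n => Hx fb.
  rewrite sw_conv_cut0 //; apply: (sw_ext Hx) => p q Hp Hq.
  by apply: (sw_ext Hy) => p' q' Hp' Hq'; rewrite cat0s (conv1 (m := i)).
rewrite idx_le_cons => /andP[ji s1i].
rewrite deg_cons.
set t2 := (0, c)%N :: s2; set t1 := s1 ++ [:: (i, a)].
set s' := s1 ++ (i, a + c)%N :: idx_shift i s2 => Hx fb.
have t1i : idx_le i t1 by rewrite idx_le_cat idx_le_cons leqnn s1i.
have t2m : idx_le m t2 by [].
have s'm : idx_le (i + m) s'.
  rewrite idx_le_cat idx_le_cons leq_addr idx_le_shift s2m !andbT.
  exact: idx_leW (leq_addr m i) s1i.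
have dt1 : deg t1 = (deg s1 + a)%N by rewrite deg_cat /deg /= addn0.
have dt2 : deg t2 = (c + deg s2)%N by [].
have ds' : deg s' = (deg s1 + a + (c + deg s2))%N.
  by rewrite deg_cat deg_cons deg_shift; lia.
have jr : (j <= deg s1 + a + i)%N by lia.
have Hx' : H (k + deg s')%N x by rewrite ds' !addnA in Hx *.
have Hs v : H (deg s') v ->
    H (deg s1 + a + i + (c + deg s2 + m))%N (conv s' v y).
  move=> Hv; rewrite (_ : _ + _ = deg s' + (i + m))%N; last by rewrite ds'; lia.
  exact: hom_conv.
have E : (k + deg s1 + a + i = k + (deg s1 + a + i))%N by rewrite !addnA.
rewrite /= (sw_push (n := k + (deg s1 + a + i + (c + deg s2 + m))) Hx') /=; first last.
- move=> u v Hu Hv; apply: hom_b => //; last exact: Hs.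
  by apply: leq_trans jr _; apply: leq_addr.
- by rewrite addnA -E; apply: (ug_swlin ug).
have fbl u p p' : H k u -> H (deg s1 + a)%N p -> H i p' ->
    H (k + deg s1 + a + i)%N (b j u (conv t1 p p')).
  move=> Hu Hp Hp'; rewrite E; apply: hom_b => //.
  by rewrite -dt1; apply: hom_conv => //; rewrite dt1.
have fbr q q' : H (c + deg s2)%N q -> H m q' -> H (c + deg s2 + m)%N (conv t2 q q').
  by move=> Hq Hq'; rewrite -dt2; apply: hom_conv.
transitivity (sw k (deg s') (fun u v => sw (deg s1 + a) (c + deg s2) (fun p q =>
    sw i m (fun p' q' => f (b j u (conv t1 p p')) (conv t2 q q')) y) v) x).
  apply: (sw_ext Hx') => u v Hu Hv.
  rewrite E (ug_compat_right ug) //; last first.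
  - by rewrite -E.
  - exact: Hs.
  rewrite -ds' in IHs.
  apply: (IHs _ (fun p q => f (b j u p) q)) => //.
  split=> z Hz; last by apply: fb.2; rewrite E; apply: hom_b.
  apply: (linear_on_comp (fb.1 _ Hz)); first exact: linear_on_br Hu.
  by move=> p Hp; rewrite E; apply: hom_b.
rewrite ds' -(ug_coassoc ug (f := fun u p q => sw i m (fun p' q' =>
    f (b j u (conv t1 p p')) (conv t2 q q')) y)); first last.
- by rewrite !addnA in Hx *.
- split=> z z' Hz Hz'; apply: (linear_on_swr Hy) => p' q' Hp' Hq'.
  + apply: (linear_on_comp (fb.1 _ (fbr _ _ Hz' Hq'))) => [|p Hp]; last exact: fbl.
    by apply: (linear_on_bl jr); rewrite -dt1; apply: hom_conv => //; rewrite dt1.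
  + apply: (linear_on_comp (fb.1 _ (fbr _ _ Hz' Hq'))) => [|p Hp]; last exact: fbl.
    apply: (linear_on_comp (linear_on_br jr Hz)).
      by rewrite -dt1; apply: linear_on_convl Hp'.
    by rewrite -dt1 => p Hp; apply: hom_conv.
  + apply: (linear_on_comp (fb.2 _ (fbl _ _ _ Hz Hz' Hp'))) => [|q Hq]; last exact: fbr.
    by rewrite -dt2; apply: linear_on_convl Hq'.
rewrite addnA; apply: sw_ext => [|u v Hu Hv]; first by rewrite !addnA in Hx *.
rewrite -addnA in Hu; rewrite sw_exchange.
apply: (sw_ext Hy) => p' q' Hp' Hq'.
rewrite dt1 (sw_push (n := k + deg s1 + a + i) (g := f ^~ (conv t2 v q')) Hu) //.
  exact: fb.1 (fbr _ _ Hv Hq').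
by move=> p q Hp Hq; apply: fbl.
Qed.

Lemma b_conv m r j s x y z : idx_le m s -> (j <= r)%N -> H (deg s) x -> H m y ->
  H r z -> b j (conv s x y) z = conv (idx_shift j s) x (b j y z).
Proof.
move=> + jr + Hy Hz; elim: s x => [|[i k] s IHs] x.
  move=> _ Hx; rewrite /= (ug_assoc ug (n := 0) (m := m) (r := r)) // add0n.
  apply: (b_deg0 (m := m + r)) => //; last exact: hom_b.
  by apply: leq_trans jr _; apply: leq_addl.
move=> /andP[/= im sm] Hx.
have ims : (i <= deg s + m)%N by apply: leq_trans im _; apply: leq_addl.
rewrite (sw_push (n := k + (deg s + m)) (g := b j ^~ z) Hx).
- rewrite deg_shift; apply: (sw_ext Hx) => u v Hu Hv.
  rewrite (ug_assoc ug (n := k) (m := deg s + m) (r := r)) //; last exact: hom_conv.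
  by rewrite IHs // addnC.
- exact: linear_on_bl Hz.
- by move=> u v Hu Hv; apply: hom_b => //; apply: hom_conv.
Qed.

(** One use of the grafting axiom per block, whose strict inequality is the condition on [s]. Once y
    stands inside, its [n] letters precede every insertion point of x, hence the shift by [n]. *)
Lemma b_conv_graft n r k s x y z : all (fun p => k < p.1)%N s -> idx_le r s ->
  (k <= r)%N -> H (deg s) x -> H n y -> H r z ->
  b k y (conv s x z) = conv (idx_shift n s) x (b k y z).
Proof.
move=> + + kr + Hy Hz; elim: s x => [|[j l] s IHs] x.
  (* No block is left and x has degree 0, where the grafting axiom gives nothing; the two counit
     laws, applied to [f], move x past y. *)
  move=> _ _ Hx; pose f u v := b 0 u (b k y (b 0 v z)).
  have bf : bilinear_on 0 0 f.
    have Hv v : H 0 v -> H (n + r)%N (b k y (b 0 v z)).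
      by move=> Hv; apply: hom_b => //; apply: (hom_b (n := 0)).
    split=> w Hw.
      by apply: (@linear_on_bl _ (n + r)) => //; apply: Hv.
    apply: (linear_on_comp (g := b 0 w) (m := n + r)) => [||v]; last exact: Hv.
      exact: linear_on_br Hw.
    apply: (linear_on_comp (g := b k y) (m := r)) => [||v Hv'].
    - exact: linear_on_br Hy.
    - exact: (@linear_on_bl _ r).
    - exact: (hom_b (n := 0)).
  have := ug_counitl ug bf Hx; rewrite (ug_counitr ug bf Hx) /f.
  rewrite (ug_1b ug (m := r)) // (ug_1b ug (m := n + r)) //.
  by apply: hom_b => //; apply: (hom_b (n := 0)).
move=> /andP[/= kj ks] /andP[/= jr sr] Hx.
have jrs : (j <= deg s + r)%N by apply: leq_trans jr _; apply: leq_addl.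
have krs : (k <= l + (deg s + r))%N by lia.
rewrite deg_shift (sw_push (n := l + (deg s + r)) (g := b k y) Hx).
- apply: (sw_ext Hx) => u v Hu Hv.
  rewrite (ug_graft ug (n := n) (m := l) (r := deg s + r)) //; last exact: hom_conv.
  by rewrite IHs // addnC.
- exact: linear_on_br Hy.
- by move=> u v Hu Hv; apply: hom_b => //; apply: hom_conv.
Qed.

(* In words, true stands for a letter of the left factor x and false for a
   letter of the right factor y.  The block (i, k) of [blocks 0 0 v] records
   the number k (possibly 0) of x's between the i-th and the (i+1)-th y. *)
Fixpoint blocks a k (v : seq bool) : seq (nat * nat) :=
  match v with
  | [::] => [:: (a, k)]
  | true :: v' => blocks a k.+1 v'
  | false :: v' => (a, k) :: blocks a.+1 0 v'
  end.

Definition trues (v : seq bool) := count id v.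
Definition falses (v : seq bool) := count negb v.

Lemma trues_falses v : (trues v + falses v)%N = size v.
Proof. by rewrite -(count_predC id v). Qed.

Lemma deg_blocks a k v : deg (blocks a k v) = (k + trues v)%N.
Proof.
elim: v a k => [|[] v IHv] a k; first by rewrite deg_cons.
  by rewrite /= IHv /trues /=; lia.
by rewrite /= deg_cons IHv /trues /=; lia.
Qed.

Lemma idx_le_blocks m a k v : (a + falses v <= m)%N -> idx_le m (blocks a k v).
Proof.
rewrite /falses; elim: v a k => [|[] v IHv] a k /= h.
- by rewrite addn0 in h; rewrite h.
- exact: IHv.
- by rewrite (leq_trans (leq_addr _ _) h) IHv // addSnnS.
Qed.

Lemma idx_gt_blocks c a k v : (c < a)%N -> all (fun p => c < p.1)%N (blocks a k v).
Proof.
elim: v a k => [|[] v IHv] a k /= h; [by rewrite h | exact: IHv |].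
by rewrite h IHv // ltnW.
Qed.

Lemma blocks_shift i a k v : blocks (i + a) k v = idx_shift i (blocks a k v).
Proof.
by elim: v a k => [|[] v IHv] a k //=; rewrite ?IHv // -addnS IHv.
Qed.

(** The last block of a prefix stays open: its [c] letters may be continued by the word that
    follows. This is the block through which a cut between [v1] and [v2] passes. *)
Lemma blocks_split v1 a k : exists s c, blocks a k v1 = s ++ [:: (a + falses v1, c)%N] /\
  idx_le (a + falses v1) s /\
  forall v2, blocks a k (v1 ++ v2) = s ++ blocks (a + falses v1) c v2.
Proof.
elim: v1 a k => [|[] v1 IHv] a k.
- by exists [::], k; rewrite addn0.
- by have [s [c h]] := IHv a k.+1; exists s, c.
have [s [c [E [h1 h2]]]] := IHv a.+1 0%N.
exists ((a, k) :: s), c; rewrite /falses /= add1n addnS -addSn.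
split; first by rewrite E.
split=> [|v2]; last by rewrite h2.
by apply/andP; split; [rewrite /=; lia | exact: h1].
Qed.

(** One choice of [d] and [s] serves all starting values, so the same data describe [v] on its own
    and as a continuation of another word. *)
Lemma blocks_head v : exists d s, forall a k,
  blocks a k v = (a, (k + d)%N) :: idx_shift a s.
Proof.
elim: v => [|[] v [d [s IHv]]].
- by exists 0%N, [::] => a k; rewrite addn0.
- by exists d.+1, s => a k; rewrite /= IHv addSnnS.
by exists 0%N, (blocks 1 0 v) => a k; rewrite /= addn0 -blocks_shift addn1.
Qed.

Lemma blocks_false a k v1 v2 : blocks a k (v1 ++ false :: v2) =
  blocks a k v1 ++ blocks (a + falses v1).+1 0 v2.
Proof.
by have [s [c [-> [_ ->]]]] := blocks_split v1 a k; rewrite -catA.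
Qed.

Lemma blocks_nseq_true a k n : blocks a k (nseq n true) = [:: (a, (k + n)%N)].
Proof. by elim: n k => [|n IHn] k /=; rewrite ?addn0 // IHn addSnnS. Qed.

(** The product of x and y prescribed by a two-letter word. For the word of a shuffle it will be
    identified with the nested product of the theorem. *)
Definition word v := conv (blocks 0 0 v).

Lemma deg_blocks0 a v : deg (blocks a 0 v) = trues v.
Proof. exact: deg_blocks. Qed.

Lemma hom_word v x y : H (trues v) x -> H (falses v) y -> H (size v) (word v x y).
Proof.
move=> Hx Hy; rewrite -trues_falses -(deg_blocks0 0).
by apply: hom_conv; rewrite ?deg_blocks0 // idx_le_blocks.
Qed.

Lemma word_bil v : bilinear_on (trues v) (falses v) (word v).
Proof. by rewrite -(deg_blocks0 0); apply: conv_bil; rewrite idx_le_blocks. Qed.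

(** The cut passes through the open block at the end of [v1], so [sw_conv_cut] applies. This is the
    coproduct formula of a shuffle bialgebra with words in place of shuffles; the unit absorbs the
    cases in which a side receives no x or no y. *)
Lemma word_cut (W : lmodType K) v1 v2 (f : B -> B -> W) x y :
  H (trues v1 + trues v2)%N x -> H (falses v1 + falses v2)%N y ->
  bilinear_on (size v1) (size v2) f ->
  sw (size v1) (size v2) f (word (v1 ++ v2) x y) =
  sw (trues v1) (trues v2) (fun p q => sw (falses v1) (falses v2) (fun p' q' =>
    f (word v1 p p') (word v2 q q')) y) x.
Proof.
have [s1 [c [E1 [s1i E12]]]] := blocks_split v1 0 0.
have [d [s2 E2]] := blocks_head v2.
have E20 : blocks 0 0 v2 = (0%N, d) :: s2.
  by rewrite E2; congr (_ :: _); elim: s2 {E2} => [|[i k] s IHs] //=; rewrite IHs.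
have D1 : trues v1 = (deg s1 + c)%N.
  by rewrite -(deg_blocks0 0) E1 deg_cat deg_cons addn0.
have D2 : trues v2 = (d + deg s2)%N by rewrite -(deg_blocks0 0) E20.
have s2m : idx_le (falses v2) s2.
  have := @idx_le_blocks (falses v2) 0 0 v2 (leqnn _).
  by rewrite E20 idx_le_cons => /andP[].
rewrite -!trues_falses D1 D2 /word E12 E2 E1 E20 add0n.
exact: sw_conv_cut.
Qed.

(** * Associativity on three-letter words *)

Section Associativity.
Variables (T : Type) (X P : pred T).
Hypothesis XP : subpred X P.
Let Y := predI P (predC X).
Let Z := predC P.

Lemma count_XY u : (count X u + count Y u)%N = count P u.
Proof.
elim: u => //= t u IHu; case: (X t) (XP (x := t)) => [->|_] //=.
  by rewrite -IHu; lia.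
by rewrite -IHu andbT; lia.
Qed.

Lemma trues_map (p : pred T) u : trues (map p u) = count p u.
Proof. by rewrite /trues count_map. Qed.

Lemma falses_map (p : pred T) u : falses (map p u) = count (predC p) u.
Proof. by rewrite /falses count_map. Qed.

Lemma trues_XP u : trues (map X (filter P u)) = count X u.
Proof.
rewrite trues_map count_filter; apply: eq_count => t /=.
by case: (X t) (XP (x := t)) => // ->.
Qed.

Lemma falses_XP u : falses (map X (filter P u)) = count Y u.
Proof.
by rewrite falses_map count_filter; apply: eq_count => t /=; rewrite andbC.
Qed.

Lemma trues_PX u : trues (map P (filter (predC X) u)) = count Y u.
Proof. by rewrite trues_map count_filter. Qed.

Lemma falses_PX u : falses (map P (filter (predC X) u)) = count Z u.
Proof.
rewrite falses_map count_filter; apply: eq_count => t /=.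
by case: (X t) (XP (x := t)) => [->|] //; rewrite andbT.
Qed.

Lemma falses_X u : falses (map X u) = (count Y u + count Z u)%N.
Proof.
have := count_XY u; have := count_predC P u; have := count_predC X u.
by rewrite falses_map /Z; lia.
Qed.

Lemma map_all (p : pred T) u : all p u -> map p u = nseq (size u) true.
Proof. by elim: u => //= t u IHu /andP[-> /IHu->]. Qed.

(* The letters of u belong to x (X), to y (P but not X) or to z (not P). *)
Lemma word_assoc u a r x y z : H (count X u) x -> H (count Y u) y -> H r z ->
  (a + count Z u <= r)%N ->
  conv (blocks a 0 (map P u)) (word (map X (filter P u)) x y) z =
  conv (blocks a 0 (map X u)) x
       (conv (blocks a 0 (map P (filter (predC X) u))) y z).
Proof.
(* Induction on the length of [u], with [a] the number of z's already passed. *)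
elim: {u}(size u).+1 {-2}u (ltnSn (size u)) a x y => // N IHN u ltN a x y Hx Hy Hz ar.
(* Without a z there is a single operator at index [a], and the claim is [b_conv]. *)
have [Pu|Pu] := boolP (all P u).
  have aR : (a <= r)%N by apply: leq_trans ar; apply: leq_addr.
  have PX : all P (filter (predC X) u).
    by rewrite all_filter; apply: sub_all Pu => t /= ->; apply: implybT.
  rewrite (all_filterP Pu) (map_all Pu) (map_all PX) !blocks_nseq_true !add0n.
  have cZ : count Z u = 0%N.
    by apply/eqP; rewrite -leqn0 leqNgt -has_count has_predC Pu.
  have fX : falses (map X u) = count Y u by rewrite falses_X cZ addn0.
  have cY : size (filter (predC X) u) = count Y u.
    by rewrite size_filter -fX falses_map.
  have Hx' : H (trues (map X u)) x by rewrite trues_map.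
  have Hy' : H (falses (map X u)) y by rewrite fX.
  have Hw : H (size u) (word (map X u) x y).
    by rewrite -(size_map X); apply: hom_word.
  rewrite !(conv1 (m := r)) //; last by rewrite cY.
  rewrite (b_conv (m := count Y u) (r := r)) //.
  - by rewrite -blocks_shift addn0.
  - by rewrite -fX idx_le_blocks.
  - by rewrite deg_blocks0.
have hZ : has Z u by rewrite has_predC.
case/split_find: hZ ltN Hx Hy ar => t u1 u2 Zt.
rewrite has_predC negbK => Pu1.
have Pt : P t = false by apply: negbTE.
have Xt : X t = false by apply/negP => /XP; rewrite Pt.
have cZ1 : count Z u1 = 0%N.
  by apply/eqP; rewrite -leqn0 leqNgt -has_count has_predC Pu1.
rewrite -cats1 -catA /= !count_cat /= !filter_cat /= !map_cat /= ?Xt ?Pt /= ?Pt /=.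
rewrite !size_cat /= cZ1 !add0n !add1n (all_filterP Pu1) (map_all Pu1).
rewrite -/Y => ltN Hx Hy ar.
have PX1 : all P (filter (predC X) u1).
  by rewrite all_filter; apply: sub_all Pu1 => t' /= ->; apply: implybT.
have fX1 : falses (map X u1) = count Y u1 by rewrite falses_X cZ1 addn0.
have cY1 : size (filter (predC X) u1) = count Y u1.
  by rewrite size_filter -fX1 falses_map.
have c1 : (count X u1 + count Y u1 = size u1)%N.
  by rewrite count_XY; apply/eqP; rewrite -all_count.
rewrite (map_all PX1) !blocks_false !blocks_nseq_true !add0n cY1 fX1.
have fn n : falses (nseq n true) = 0%N by rewrite /falses count_nseq.
rewrite !fn !addn0.
set g1 := blocks a 0 (map X u1).
set l2 := blocks a.+1 0 (map P u2); set v2 := map X (filter P u2).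
set d2 := blocks a.+1 0 (map P (filter (predC X) u2)).
(* The y's of [u1] are right-hand letters for x, but not for the operators that act on z alone. The
   resulting difference of indices is the shift that [b_conv_graft] produces. *)
have -> : blocks (a + count Y u1).+1 0 (map X u2) =
    idx_shift (count Y u1) (blocks a.+1 0 (map X u2)).
  by rewrite -blocks_shift addnS addnC.
set g2 := blocks a.+1 0 (map X u2).
have dg1 : deg g1 = count X u1 by rewrite deg_blocks0 trues_map.
have dg2 : deg g2 = count X u2 by rewrite deg_blocks0 trues_map.
have dl2 : deg l2 = count P u2 by rewrite deg_blocks0 trues_map.
have dd2 : deg d2 = count Y u2 by rewrite deg_blocks0 trues_PX.
have l2r : idx_le r l2 by apply: idx_le_blocks; rewrite falses_map -/Z; lia.
have d2r : idx_le r d2 by apply: idx_le_blocks; rewrite falses_PX; move: ar; clear; lia.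
have g1r : idx_le (count Y u1 + r) g1 by apply: idx_le_blocks; rewrite fX1; move: ar; clear; lia.
have g2r : idx_le (deg d2 + r) g2.
  by apply: idx_le_blocks; rewrite falses_X dd2; move: ar; clear; lia.
have tv2 : trues v2 = count X u2 by apply: trues_XP.
have fv2 : falses v2 = count Y u2 by apply: falses_XP.
have aR : (a <= r)%N by move: ar; clear; lia.
have Hx' : H (trues (map X u1) + trues v2)%N x by rewrite tv2 trues_map.
have Hy' : H (falses (map X u1) + falses v2)%N y by rewrite fX1 fv2.
have s12 : size v2 = count P u2 by rewrite size_map size_filter.
have Hw12 : H (size u1 + count P u2)%N (word (map X u1 ++ v2) x y).
  rewrite -s12 -(size_map X u1) -size_cat; apply: hom_word.
    by rewrite /trues count_cat.
  by rewrite /falses count_cat.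
rewrite [LHS]/= -/l2 dl2 -s12 -{1}(size_map X u1) word_cut //; last first.
  by rewrite s12 size_map -dl2; apply: (@bil_b_conv a (size u1) r) => //; apply: leq_trans aR _; apply: leq_addl.
rewrite trues_map fX1 tv2 fv2.
have Hx'' : H (deg g1 + deg (idx_shift (count Y u1) g2))%N x.
  by rewrite deg_shift dg1 dg2.
rewrite cat1s; set c2 := conv ((a, _) :: d2) y z.
have Hc2 : H (count Y u1 + (deg d2 + r))%N c2.
  rewrite addnA -(deg_cons a); apply: hom_conv => //; last by rewrite deg_cons dd2.
  by rewrite idx_le_cons aR.
rewrite (conv_cat (m := count Y u1 + (deg d2 + r))) //; last first.
- by rewrite idx_le_shift.
- by apply: idx_leW g1r; clear; lia.
rewrite deg_shift dg1 dg2; apply: (sw_ext Hx) => p q Hp Hq.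
have Hyd : H (count Y u1 + deg d2)%N y by rewrite dd2.
have g2r' : idx_le (count Y u1 + (deg d2 + r)) (idx_shift (count Y u1) g2).
  by rewrite idx_le_shift.
have Hq' : H (deg (idx_shift (count Y u1) g2)) q by rewrite deg_shift dg2.
have Hin p' q' : H (count Y u1) p' -> H (deg d2) q' ->
    H (count Y u1 + (deg d2 + r))%N (b a p' (conv d2 q' z)).
  move=> Hp' Hq'2; apply: hom_b => //; last exact: hom_conv.
  by apply: leq_trans aR _; apply: leq_addl.
rewrite /c2 /= (sw_push (g := conv _ q) Hyd (linear_on_convr g2r' Hq')) //.
rewrite (sw_push (n := deg (idx_shift (count Y u1) g2) +
  (count Y u1 + (deg d2 + r))) (g := conv g1 p) Hyd) //; first last.
- by move=> p' q' Hp' Hq'2; apply: hom_conv => //; apply: Hin.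
- apply: linear_on_convr; last by rewrite dg1.
  by apply: idx_leW g1r; clear; lia.
rewrite -dd2; apply: (sw_ext Hyd) => p' q' Hp' Hq'2.
have Hqw : H (size v2) (word v2 q q').
  by apply: hom_word; rewrite ?tv2 ?fv2 -?dd2.
have aR' : (a <= deg d2 + r)%N by apply: leq_trans aR _; apply: leq_addl.
(* The letters after the first z are settled by induction, with [a.+1] as the starting index. *)
rewrite /l2 (IHN u2) //; first last.
- by move: ar; clear; lia.
- by rewrite -dd2.
- by move: ltN; clear; lia.
rewrite -/g2 -/d2 (b_conv (m := count Y u1) (r := deg g2 + (deg d2 + r))) //.
- rewrite -blocks_shift addn0 -/g1; congr (conv _ _ _).
  (* The part [p'] of y before the first z acts at [a], and the operators in [q] act at indices at
     least [a.+1], so [p'] may be moved inward past them. *)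
  apply: (b_conv_graft (r := deg d2 + r)) => //.
  + exact: idx_gt_blocks.
  + by rewrite dg2.
  + exact: hom_conv.
- by rewrite -fX1 idx_le_blocks.
- by apply: leq_trans aR' _; apply: leq_addl.
- by rewrite deg_blocks0 trues_map.
- by apply: hom_conv => //; rewrite ?dg2 //; apply: hom_conv.
Qed.

End Associativity.

(** A normal form without empty blocks, in which the gaps of a word and the compositions of a
    shuffle can be compared. The prefix [s1] only carries the induction. *)
Lemma conv_filter m s1 s x y : idx_le m (s1 ++ s) -> H (deg (s1 ++ s)) x -> H m y ->
  conv (s1 ++ s) x y = conv (s1 ++ [seq p <- s | p.2 != 0%N]) x y.
Proof.
move=> + + Hy; elim: s s1 => [|[i [|k]] s IHs] s1 //= sm Hx; last first.
  have E t : s1 ++ (i, k.+1) :: t = (s1 ++ [:: (i, k.+1)]) ++ t by rewrite -catA.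
  by rewrite (E s) (E (filter _ s)); apply: IHs; rewrite -E.
move: sm; rewrite idx_le_cat idx_le_cons => /and3P[s1m im sm].
rewrite deg_cat deg_cons add0n in Hx.
rewrite (conv_zero (m := m)) //.
by apply: IHs; rewrite ?idx_le_cat ?s1m // deg_cat.
Qed.

Lemma word_unit_r v x : falses v = 0%N -> H (trues v) x -> word v x e = x.
Proof.
move=> fv Hx; have Ev : v = nseq (trues v) true.
  rewrite /trues; elim: v fv {Hx} => [|[] v IHv] //.
  by move=> fv; rewrite /= -IHv.
by rewrite /word {1}Ev blocks_nseq_true add0n (conv1 (m := 0)) ?(ug_b1 ug Hx) //;
  apply: (ug_one ug).
Qed.

Lemma word_unit_l v y : trues v = 0%N -> H (falses v) y -> word v e y = y.
Proof.
move=> tv Hy; rewrite /word (conv_deg0 (m := falses v)) //.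
- exact: (ug_1b ug _ Hy).
- exact: idx_le_blocks.
- by rewrite deg_blocks0.
- exact: (ug_one ug).
Qed.

End Convolution.

(** * Adjoining a unit *)

Section Unitization.
Variables (K : fieldType) (A : lmodType K) (pr : nat -> A -> A).
Variables (bop : nat -> A -> A -> A) (Delta : A -> seq (A * A)).
Hypotheses (grA : graded pr) (gbA : grafting_bialgebra pr Delta bop).

Local Notation homog := (homog pr).
Local Notation hD := (hD pr Delta).

Definition bilin (W : lmodType K) (f : A -> A -> W) : Prop :=
  (forall c x x' y, f (c *: x + x') y = c *: f x y + f x' y) /\
  (forall c x y y', f x (c *: y + y') = c *: f x y + f x y').

Lemma pr_lin n c x y : pr n (c *: x + y) = c *: pr n x + pr n y.
Proof. by have [h _ _ _] := grA; apply: h. Qed.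

Lemma pr_idem n x : pr n (pr n x) = pr n x.
Proof. by have [_ h _ _] := grA; apply: h. Qed.

Lemma pr_orth n m x : n != m -> pr n (pr m x) = 0.
Proof. by have [_ _ h _] := grA; apply: h. Qed.

Lemma linear_map0 (V W : lmodType K) (g : V -> W) :
  (forall c x y, g (c *: x + y) = c *: g x + g y) -> g 0 = 0.
Proof.
move=> gl; have := gl (-1) 0 0.
by rewrite scaler0 addr0 scaleN1r addNr.
Qed.

Lemma linear_map_sum (V W : lmodType K) (g : V -> W) (I : Type) (s : seq I)
    (F : I -> V) : (forall c x y, g (c *: x + y) = c *: g x + g y) ->
  g (\sum_(i <- s) F i) = \sum_(i <- s) g (F i).
Proof.
move=> gl; elim: s => [|i s IHs]; first by rewrite !big_nil (linear_map0 gl).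
by rewrite !big_cons -IHs -[F i]scale1r gl !scale1r.
Qed.

Lemma pr0 n : pr n 0 = 0.
Proof. exact: (linear_map0 (pr_lin n)). Qed.

Lemma homog_pr n x : homog n (pr n x).
Proof. exact: pr_idem. Qed.

Lemma pr_homog k n x : homog n x -> pr k x = if k == n then x else 0.
Proof. by move=> <-; case: eqVneq => [->|/pr_orth->]; rewrite ?pr_idem. Qed.

Lemma homog0 n : homog n 0.
Proof. exact: pr0. Qed.

Lemma homog_lin n c x y : homog n x -> homog n y -> homog n (c *: x + y).
Proof. by move=> Hx Hy; rewrite /Defs.homog pr_lin Hx Hy. Qed.

Lemma homog_deg0 x : homog 0 x -> x = 0.
Proof. by case: gbA => [[_ A0 _ _] _] <-; apply: A0. Qed.

Lemma bop_spec n m i x y : (i <= m)%N -> homog n x -> homog m y ->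
  [/\ homog (n + m) (bop i x y),
      (forall c x', homog n x' -> bop i (c *: x + x') y = c *: bop i x y + bop i x' y) &
      (forall c y', homog m y' -> bop i x (c *: y + y') = c *: bop i x y + bop i x y')].
Proof. by case: gbA => [[[bok _] _ _ _] _] im Hx Hy; apply: bok. Qed.

Lemma bop0l m i y : (i <= m)%N -> homog m y -> bop i 0 y = 0.
Proof.
move=> im Hy; have [_ h _] := bop_spec im (homog0 0) Hy.
by have := h (-1) 0 (homog0 0); rewrite scaler0 addr0 scaleN1r addNr.
Qed.

Lemma bop0r n m i x : (i <= m)%N -> homog n x -> bop i x 0 = 0.
Proof.
move=> im Hx; have [_ _ h] := bop_spec im Hx (homog0 m).
by have := h (-1) 0 (homog0 m); rewrite scaler0 addr0 scaleN1r addNr.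
Qed.

Lemma bilin_multilin (W : lmodType K) (f : A -> A -> W) : bilin f ->
  multilin 2 (fun l => f (nth 0 l 0) (nth 0 l 1)).
Proof.
by move=> [fl fr] [|u [|? ?]] [|v [|? ?]] //= _ c a b; rewrite ?fl ?fr.
Qed.

Lemma teq2_bilin (W : lmodType K) (f : A -> A -> W) t t' : teq2 t t' -> bilin f ->
  \sum_(p <- t) f p.1 p.2 = \sum_(p <- t') f p.1 p.2.
Proof. by move=> tt' /bilin_multilin/tt'; rewrite !big_map. Qed.

Lemma Delta_lin (W : lmodType K) (f : A -> A -> W) c a b : bilin f ->
  \sum_(p <- Delta (c *: a + b)) f p.1 p.2 =
  c *: \sum_(p <- Delta a) f p.1 p.2 + \sum_(p <- Delta b) f p.1 p.2.
Proof.
case: gbA => [[_ _ [Dl _ _] _] _] bf; rewrite (teq2_bilin (Dl c a b) bf).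
rewrite big_cat big_map /= scaler_sumr; congr (_ + _).
apply: eq_bigr => p _; have := bf.1 c p.1 0 p.2.
by rewrite addr0 (linear_map0 (g := f^~ p.2)) ?addr0 // => *; apply: bf.1.
Qed.

Lemma bilin0l (W : lmodType K) (f : A -> A -> W) y : bilin f -> f 0 y = 0.
Proof. by move=> bf; apply: (linear_map0 (g := f^~ y)) => *; apply: bf.1. Qed.

Lemma bilin0r (W : lmodType K) (f : A -> A -> W) x : bilin f -> f x 0 = 0.
Proof. by move=> bf; apply: (linear_map0 (g := f x)) => *; apply: bf.2. Qed.

Lemma bilin_pr (W : lmodType K) (f : A -> A -> W) k l : bilin f ->
  bilin (fun p q => f (pr k p) (pr l q)).
Proof. by move=> bf; split=> *; rewrite pr_lin ?bf.1 ?bf.2. Qed.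

(** The pairs listed in [Delta z] need not be homogeneous; only an equivalent tensor expression has
    homogeneous terms. The sum is moved to that expression, where each term is killed by a
    projection. *)
Lemma Delta_deg (W : lmodType K) (f : A -> A -> W) n k l z : bilin f ->
  homog n z -> (k + l)%N != n ->
  \sum_(p <- Delta z) f (pr k p.1) (pr l p.2) = 0.
Proof.
case: gbA => [[_ _ [_ _ Dh] _] _] bf /Dh[t [zt th]] kln.
rewrite (teq2_bilin zt (bilin_pr k l bf)) big_seq big1 // => p.
case/th=> i [i0 ilt Hp1 Hp2]; rewrite (pr_homog k Hp1) (pr_homog l Hp2).
case: eqP => [ki|_]; last exact: bilin0l.
by case: eqP => [li|_]; [lia | exact: bilin0r].
Qed.

(** The homogeneous components of z in other degrees contribute 0 by [Delta_deg]. This serves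
    iterated coproducts, where the inner one is applied to a tensor factor that need not be
    homogeneous as listed. *)
Lemma Delta_pr (W : lmodType K) (f : A -> A -> W) k l z :
  bilin (fun p q => f (pr k p) (pr l q)) ->
  \sum_(p <- Delta (pr (k + l) z)) f (pr k p.1) (pr l p.2) =
  \sum_(p <- Delta z) f (pr k p.1) (pr l p.2).
Proof.
move=> bg; pose phi x := \sum_(p <- Delta x) f (pr k p.1) (pr l p.2).
have phil c x y : phi (c *: x + y) = c *: phi x + phi y.
  exact: (Delta_lin c x y bg).
have [_ _ _ /(_ z)[N ->]] := grA.
rewrite -!/(phi _) (linear_map_sum _ _ (pr_lin (k + l))) !(linear_map_sum _ _ phil).
apply: eq_bigr => i _; have [<-|kli] := eqVneq (k + l)%N i; first by rewrite pr_idem.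
rewrite pr_orth // (linear_map0 phil) -(Delta_deg bg (homog_pr i z) kli).
by apply: eq_bigr => p _; rewrite !pr_idem.
Qed.

Lemma Delta_graded (W : lmodType K) (f : A -> A -> W) n z : bilin f -> homog n z ->
  \sum_(p <- Delta z) f p.1 p.2 =
  \sum_(k <- iota 1 n.-1) \sum_(p <- Delta z) f (pr k p.1) (pr (n - k) p.2).
Proof.
case: gbA => [[_ _ [_ _ Dh] _] _] bf /Dh[t [zt th]].
under [RHS]eq_bigr => k _ do rewrite (teq2_bilin zt (bilin_pr k (n - k) bf)).
rewrite exchange_big (teq2_bilin zt bf) /=; apply: eq_big_seq => p /th[i [i0 ilt Hp1 Hp2]].
rewrite (bigD1_seq i) ?iota_uniq //=; last by rewrite mem_iota; lia.
rewrite Hp1 Hp2 big1 ?addr0 // => k ki.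
by rewrite (pr_homog k Hp1) (negbTE ki) (bilin0l _ bf).
Qed.

Lemma sum_hD (W : lmodType K) n x (P : pred nat) (F : nat -> A -> A -> W) :
  \sum_(q <- hD n x | P q.1) F q.1 q.2.1 q.2.2 =
  \sum_(j <- iota 1 n.-1 | P j) \sum_(p <- Delta x) F j (pr j p.1) (pr (n - j) p.2).
Proof.
rewrite /Defs.hD big_flatten big_map [RHS]big_mkcond; apply: eq_bigr => j _.
rewrite big_map /=; case: (P j) => //=.
by rewrite big_pred0_eq.
Qed.

(** * The unitization of A *)

Definition unitized : lmodType K := (K^o * A)%type.
Local Notation U := unitized.
Definition unit_U : U := (1, 0).
(** Since A has no degree 0 part, the elements of degree 0 are the scalar multiples of the unit. *)
Definition hom_U (n : nat) (u : U) : Prop := (n != 0%N -> u.1 = 0) /\ homog n u.2.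
Definition bop_U i (u v : U) : U :=
  (u.1 * v.1, u.1 *: v.2 + v.1 *: u.2 + bop i u.2 v.2).
Definition in_U (a : A) : U := (0, a).
(** The bidegree [(k, l)] component of the counital coproduct. At [k = l = 0] the first branch wins;
    the right counit law still holds there because u is a scalar multiple of the unit. The
    projections make the listed factors homogeneous whatever expression [Delta] returns. *)
Definition cop_U (k l : nat) (u : U) : seq (U * U) :=
  if k == 0%N then [:: (unit_U, u)] else
  if l == 0%N then [:: (u, unit_U)] else
  [seq (in_U (pr k p.1), in_U (pr l p.2)) | p <- Delta u.2].

Local Notation swU := (sw cop_U).

Lemma hom_U_in n a : homog n a -> hom_U n (in_U a).
Proof. by split. Qed.

Lemma in_U_lin c a b : in_U (c *: a + b) = c *: in_U a + in_U b.
Proof. by congr pair; rewrite /= ?scaler0 ?addr0. Qed.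

Lemma hom_U0 u : hom_U 0 u -> u = u.1 *: unit_U.
Proof.
by case: u => c a [_ /homog_deg0 /= ->]; congr pair; rewrite ?scaler0 // /GRing.scale /= mulr1.
Qed.

Lemma hom_U_pos n u : (0 < n)%N -> hom_U n u -> u = in_U u.2.
Proof. by case: u => c a n0 [/= -> //]; rewrite -lt0n. Qed.

Lemma hom_U_zero n : hom_U n 0.
Proof. by split=> //; apply: homog0. Qed.

Lemma hom_U_lin n c u v : hom_U n u -> hom_U n v -> hom_U n (c *: u + v).
Proof.
move=> [u1 u2] [v1 v2]; split=> [n0|]; last exact: homog_lin.
by rewrite /= u1 // v1 // addr0 scaler0.
Qed.

Lemma hom_U_one : hom_U 0 unit_U.
Proof. by split=> //; apply: homog0. Qed.

Lemma hom_U_scale n c u : hom_U n u -> hom_U n (c *: u).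
Proof. by move=> Hu; rewrite -[_ *: _]addr0; apply: hom_U_lin => //; apply: hom_U_zero. Qed.

Lemma bop_U_scalar_l m i c v : (i <= m)%N -> hom_U m v ->
  bop_U i (c *: unit_U) v = c *: v.
Proof.
move=> im [_ Hv]; rewrite /bop_U /= !scaler0 (bop0l im) // !addr0.
by congr pair; rewrite /GRing.scale /= mulr1.
Qed.

Lemma bop_U_scalar_r n c u : hom_U n u -> bop_U 0 u (c *: unit_U) = c *: u.
Proof.
move=> [_ Hu]; rewrite /bop_U /= !scaler0 (bop0r (m := 0) _ Hu) // add0r addr0.
by congr pair; rewrite /GRing.scale /= mulr1 // mulrC.
Qed.

Lemma bop_U_in i a a' : bop_U i (in_U a) (in_U a') = in_U (bop i a a').
Proof. by rewrite /bop_U /= !scale0r mul0r !add0r. Qed.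

Lemma hom_U_cases n u : hom_U n u ->
  (n = 0%N /\ exists c, u = c *: unit_U) \/
  (0 < n)%N /\ exists a, homog n a /\ u = in_U a.
Proof.
case: n => [|n] Hu; [left | right]; split=> //.
  by exists u.1; apply: hom_U0.
by exists u.2; split; [apply: Hu.2 | apply: hom_U_pos Hu].
Qed.

Lemma hom_bop_U n m i u v : (i <= m)%N -> hom_U n u -> hom_U m v ->
  hom_U (n + m) (bop_U i u v).
Proof.
move=> im Hu Hv; case: (hom_U_cases Hu) => [[n0 [c ->]]|[n0 [a [Ha ->]]]].
  by rewrite n0 (bop_U_scalar_l _ im Hv); apply: hom_U_scale.
case: (hom_U_cases Hv) => [[m0 [d ->]]|[m0 [a' [Ha' ->]]]].
  move: im; rewrite m0 leqn0 addn0 => /eqP->.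
  by rewrite (bop_U_scalar_r _ (hom_U_in Ha)); apply/hom_U_scale/hom_U_in.
by rewrite bop_U_in; apply: hom_U_in; case: (bop_spec im Ha Ha').
Qed.

Lemma add3rACA (V : zmodType) (x1 x2 y1 y2 z1 z2 : V) :
  (x1 + x2) + (y1 + y2) + (z1 + z2) = (x1 + y1 + z1) + (x2 + y2 + z2).
Proof. by rewrite [RHS]addrACA [in RHS](addrACA x1). Qed.

Lemma bop_U_bil n m i : (i <= m)%N -> bilinear_on hom_U n m (bop_U i).
Proof.
move=> im; split=> [v|u] Hu c w w' Hw Hw'; congr pair => /=.
- by rewrite mulrDl -mulrA.
- have [_ Bl _] := bop_spec im Hw.2 Hu.2; rewrite Bl; last exact: Hw'.2.
  have E : (c *: w.1) *: v.2 = c *: (w.1 *: v.2) by rewrite scalerA.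
  rewrite scalerDl (scalerDr v.1) E.
  have -> : v.1 *: (c *: w.2) = c *: (v.1 *: w.2) by rewrite !scalerA mulrC.
  by rewrite !scalerDr add3rACA.
- by rewrite mulrDr mulrCA.
- have [_ _ Br] := bop_spec im Hu.2 Hw.2; rewrite Br; last exact: Hw'.2.
  have E : (c *: w.1) *: u.2 = c *: (w.1 *: u.2) by rewrite scalerA.
  rewrite scalerDl (scalerDr u.1) E.
  have -> : u.1 *: (c *: w.2) = c *: (u.1 *: w.2) by rewrite !scalerA mulrC.
  by rewrite !scalerDr add3rACA.
Qed.

Local Opaque bop_U.

Lemma lin_U0 (W : lmodType K) n (g : U -> W) : linear_on hom_U n g -> g 0 = 0.
Proof.
move=> gl; have := gl (-1) 0 0 (hom_U_zero n) (hom_U_zero n).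
by rewrite scaler0 addr0 scaleN1r addNr.
Qed.

Lemma lin_U_scale (W : lmodType K) n (g : U -> W) c u :
  linear_on hom_U n g -> hom_U n u -> g (c *: u) = c *: g u.
Proof.
move=> gl Hu; have := gl c u 0 Hu (hom_U_zero n).
by rewrite addr0 (lin_U0 gl) addr0.
Qed.

Lemma cop_U_hom k l u p : hom_U (k + l) u -> p \in cop_U k l u ->
  hom_U k p.1 /\ hom_U l p.2.
Proof.
rewrite /cop_U; case: eqP => [->|k0]; last case: eqP => [->|l0].
- by rewrite add0n inE => Hu /eqP->; split=> //; apply: hom_U_one.
- by rewrite addn0 inE => Hu /eqP->; split=> //; apply: hom_U_one.
by move=> Hu /mapP[q _ ->]; split; apply/hom_U_in/homog_pr.
Qed.

Lemma swU_ext (W : lmodType K) k l (f g : U -> U -> W) u : hom_U (k + l) u ->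
  (forall p q, hom_U k p -> hom_U l q -> f p q = g p q) -> swU k l f u = swU k l g u.
Proof. by move=> Hu fg; apply: eq_big_seq => p /(cop_U_hom Hu)[]; apply: fg. Qed.

Lemma swU_zero (W : lmodType K) k l (f : U -> U -> W) u : hom_U (k + l) u ->
  (forall p q, hom_U k p -> hom_U l q -> f p q = 0) -> swU k l f u = 0.
Proof.
move=> Hu f0; rewrite (swU_ext (g := fun _ _ => 0) Hu) //.
by rewrite /sw big1.
Qed.

Lemma swU_0l (W : lmodType K) l (f : U -> U -> W) u : swU 0 l f u = f unit_U u.
Proof. by rewrite /sw /cop_U big_seq1. Qed.

Lemma swU_pos0 (W : lmodType K) k (f : U -> U -> W) u : (0 < k)%N ->
  swU k 0 f u = f u unit_U.
Proof. by case: k => // k _; rewrite /sw /cop_U big_seq1. Qed.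

Lemma swU_0r (W : lmodType K) k (f : U -> U -> W) u :
  bilinear_on hom_U k 0 f -> hom_U k u -> swU k 0 f u = f u unit_U.
Proof.
case: k => [|k] [fl fr] Hu; last exact: swU_pos0.
rewrite swU_0l (hom_U0 Hu) (lin_U_scale _ (fr _ hom_U_one) hom_U_one).
by rewrite (lin_U_scale _ (fl _ hom_U_one) hom_U_one).
Qed.

Lemma swU_pos (W : lmodType K) k l (f : U -> U -> W) u : (0 < k)%N -> (0 < l)%N ->
  swU k l f u = \sum_(p <- Delta u.2) f (in_U (pr k p.1)) (in_U (pr l p.2)).
Proof. by case: k l => // k [] // l _ _; rewrite /sw /cop_U big_map. Qed.

(** Tensor equality is tested only by maps bilinear on all of A. Composing with the projections
    turns a function that is bilinear on one bidegree into such a map. *)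
Lemma bilin_in (W : lmodType K) k l (f : U -> U -> W) :
  bilinear_on hom_U k l f -> bilin (fun p q => f (in_U (pr k p)) (in_U (pr l q))).
Proof.
have Hp j p := hom_U_in (homog_pr j p).
by move=> [fl fr]; split=> c *; rewrite pr_lin in_U_lin ?(fl _ (Hp _ _)) ?(fr _ (Hp _ _)).
Qed.

Lemma swU_lin (W : lmodType K) k l (f : U -> U -> W) :
  bilinear_on hom_U k l f -> linear_on hom_U (k + l) (swU k l f).
Proof.
move=> bf c u u' Hu Hu'.
case: k => [|k] in bf Hu Hu' *; first by rewrite !swU_0l (bf.2 _ hom_U_one).
case: l => [|l] in bf Hu Hu' *.
  by rewrite !addn0 in Hu Hu'; rewrite !swU_0r ?(bf.1 _ hom_U_one) //; apply: hom_U_lin.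
by rewrite !swU_pos //; apply: (Delta_lin c u.2 u'.2 (bilin_in bf)).
Qed.

Lemma swU_coassoc (W : lmodType K) k l m (f : U -> U -> U -> W) u :
  trilinear_on hom_U k l m f -> hom_U (k + l + m) u ->
  swU (k + l) m (fun v w => swU k l (fun p q => f p q w) v) u =
  swU k (l + m) (fun p v => swU l m (f p) v) u.
Proof.
move=> [f1 f2 f3] Hu.
case: k => [|k] in f1 f2 f3 Hu *.
  rewrite swU_0l add0n; apply: (swU_ext Hu) => p q _ _; exact: swU_0l.
case: l => [|l] in f1 f2 f3 Hu *.
  rewrite addn0 add0n in Hu *; apply: (swU_ext Hu) => p q Hp Hq.
  rewrite swU_0l swU_0r //; split=> v Hv; [exact: f1 | exact: f2].
case: m => [|m] in f1 f2 f3 Hu *.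
  rewrite swU_pos0 // !addn0 in Hu *; apply: (swU_ext Hu) => p q Hp Hq.
  rewrite swU_0r //; split=> v Hv; [exact: f2 | exact: f3].
have Hp j p := hom_U_in (homog_pr j p).
rewrite !swU_pos ?addn_gt0 //.
pose g a b c := f (in_U (pr k.+1 a)) (in_U (pr l.+1 b)) (in_U (pr m.+1 c)).
have gm : multilin 3 (fun s => g (nth 0 s 0) (nth 0 s 1) (nth 0 s 2)).
  rewrite /g => -[|u1 [|u2 [|? ?]]] [|v1 [|v2 [|? ?]]] //= _ c a b;
    rewrite pr_lin in_U_lin; [exact: f1 | exact: f2 | exact: f3].
case: gbA => [[_ _ [_ /(_ u.2) /(_ W _ gm) + _] _] _].
rewrite !big_flatten !big_map.
under eq_bigr => p _ do rewrite big_map /=.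
under [X in _ = X -> _]eq_bigr => p _ do rewrite big_map /=.
(* [E] applies the inner coproduct to the bare factors [p.1] and [p.2], whereas [swU] projects them
   to their degree beforehand; [Delta_pr] bridges the two. *)
move=> E; transitivity (\sum_(p <- Delta u.2) \sum_(q <- Delta p.1) g q.1 q.2 p.2).
  apply: eq_bigr => p _; rewrite swU_pos //.
  have Hm := Hp m.+1 p.2.
  apply: (Delta_pr (f := fun a b => f (in_U a) (in_U b) (in_U (pr m.+1 p.2)))).
  by split=> c *; rewrite pr_lin in_U_lin; [apply: f1 | apply: f2].
rewrite E; apply: eq_bigr => p _; rewrite swU_pos //.
have Hk := Hp k.+1 p.1.
apply/esym/(Delta_pr (f := fun a b => f (in_U (pr k.+1 p.1)) (in_U a) (in_U b))).
by split=> c *; rewrite pr_lin in_U_lin; [apply: f2 | apply: f3].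
Qed.

Lemma bop_U_unit_l m i v : (i <= m)%N -> hom_U m v -> bop_U i unit_U v = v.
Proof. by move=> im Hv; rewrite -{1}[unit_U]scale1r (bop_U_scalar_l _ im Hv) scale1r. Qed.

Lemma bop_U_unit_r n u : hom_U n u -> bop_U 0 u unit_U = u.
Proof. by move=> Hu; rewrite -{1}[unit_U]scale1r (bop_U_scalar_r _ Hu) scale1r. Qed.

(** * The compatibility axioms in the unitization *)

Lemma big_pick (V : nmodType) (s : seq nat) (P : pred nat) (F : nat -> V) k :
  uniq s -> (forall j, j \in s -> P j -> j != k -> F j = 0) ->
  \sum_(j <- s | P j) F j = if (k \in s) && P k then F k else 0.
Proof.
move=> us F0; have F0' j : j \in s -> j != k -> (if P j then F j else 0) = 0.
  by move=> js jk; case: ifP => // Pj; apply: F0.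
rewrite big_mkcond; case: (boolP (k \in s)) => /= ks; last first.
  by rewrite big_seq big1 // => j js; apply: F0' => //; apply: contraNneq ks => <-.
rewrite (bigD1_seq k) //= big_seq_cond big1 ?addr0 // => j /andP[]; exact: F0'.
Qed.

(** One formula for the axioms at index 0, at an interior index and at index m. The ranges exceed
    those of the axioms by one value each: [j = m] in the first sum occurs only for [I = m] and
    yields the term y ⊗ x, and [j = 0] in the last occurs only for [I = 0] and yields x ⊗ y. *)
Lemma Delta_bop (W : lmodType K) n m I x y (F : A -> A -> W) : (0 < n)%N ->
  (0 < m)%N -> (I <= m)%N -> homog n x -> homog m y -> bilin F ->
  \sum_(p <- Delta (bop I x y)) F p.1 p.2 =
  \sum_(j <- iota 1 m | (j <= I)%N)
     swU j (m - j) (fun p q => F p.2 (bop_U (I - j) (in_U x) q).2) (in_U y) +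
  \sum_(i <- iota 1 n.-1) swU i (n - i) (fun p q => swU I (m - I) (fun p' q' =>
     F (bop_U I p p').2 (bop_U 0 q q').2) (in_U y)) (in_U x) +
  \sum_(j <- iota 0 m | (I <= j)%N)
     swU j (m - j) (fun p q => F (bop_U I (in_U x) p).2 q.2) (in_U y).
Proof.
case: gbA => [[_ _ _ compat] _] n0 m0 Im Hx Hy bF.
have [c0 cI cm] := compat _ _ _ _ Hx Hy.
pose T1 := \sum_(j <- iota 1 m.-1 | (j <= I)%N) \sum_(p <- Delta y)
  F (pr j p.1) (bop (I - j) x (pr (m - j) p.2)).
pose T3 := \sum_(j <- iota 1 m.-1 | (I <= j)%N) \sum_(p <- Delta y)
  F (bop I x (pr j p.1)) (pr (m - j) p.2).
have e1 : iota 1 m = iota 1 m.-1 ++ [:: m].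
  by case: (m) m0 => // M _; rewrite -[in LHS](addn1 M) iotaD add1n.
have e0 : iota 0 m = 0%N :: iota 1 m.-1 by case: (m) m0.
have S1 : \sum_(j <- iota 1 m | (j <= I)%N)
    swU j (m - j) (fun p q => F p.2 (bop_U (I - j) (in_U x) q).2) (in_U y) =
    T1 + if (m <= I)%N then F y x else 0.
  rewrite e1 big_cat [X in _ + X = _]big_cons big_nil /= addr0.
  congr (_ + _); last first.
    case: ifP => // mI; have -> : I = m by lia.
    by rewrite !subnn swU_pos0 // (bop_U_unit_r (hom_U_in Hx)).
  rewrite /T1 big_mkcond [RHS]big_mkcond; apply: eq_big_seq => j; rewrite mem_iota => jm.
  case: ifP => // _; rewrite swU_pos; try by [lia].
  by apply: eq_bigr => p _; rewrite bop_U_in.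
have S3 : \sum_(j <- iota 0 m | (I <= j)%N)
    swU j (m - j) (fun p q => F (bop_U I (in_U x) p).2 q.2) (in_U y) =
    (if (I <= 0)%N then F x y else 0) + T3.
  rewrite e0 big_mkcond big_cons /= -big_mkcond; congr (_ + _).
    case: ifP => //; rewrite leqn0 => /eqP->.
    by rewrite swU_0l (bop_U_unit_r (hom_U_in Hx)).
  rewrite /T3 big_mkcond [RHS]big_mkcond; apply: eq_big_seq => j; rewrite mem_iota => jm.
  case: ifP => // _; rewrite swU_pos; try by [lia].
  by apply: eq_bigr => p _; rewrite bop_U_in.
rewrite S1 S3.
have [I0|I0] := posnP I.
  rewrite I0 in T1 T3 S1 S3 *.
  have -> : T1 = 0.
    by rewrite /T1 big_seq_cond big1 // => j; rewrite mem_iota; lia.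
  rewrite (teq2_bilin c0 bF) big_cat big_map big_cons big_map /= leqNgt m0 /= !add0r.
  congr (_ + (_ + _)).
    rewrite (sum_hD n x xpredT (fun _ a b => F a (bop 0 b y))).
    apply: eq_big_seq => i; rewrite mem_iota => im.
    rewrite swU_pos; try by [lia].
    apply: eq_bigr => p _; rewrite swU_0l bop_U_in.
    by rewrite (bop_U_unit_r (hom_U_in (homog_pr i p.1))).
  by rewrite (sum_hD m y xpredT (fun _ a b => F (bop 0 x a) b)).
have [mI|mI] := leqP m I.
  have {}mI : I = m by lia.
  rewrite mI in T1 T3 S1 S3 I0 *.
  have -> : T3 = 0.
    by rewrite /T3 big_seq_cond big1 // => j; rewrite mem_iota; lia.
  rewrite (teq2_bilin cm bF) big_cat big_map big_cons big_map /= leqNgt m0 /= !addr0.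
  rewrite -addrA; congr (_ + (_ + _)).
    rewrite (sum_hD m y xpredT (fun j a b => F a (bop (m - j) x b))) /T1.
    rewrite [in RHS]big_seq_cond [in LHS]big_seq_cond; apply: eq_bigl => j.
    by rewrite mem_iota; lia.
  rewrite (sum_hD n x xpredT (fun _ a b => F (bop m a y) b)).
  apply: eq_big_seq => i; rewrite mem_iota => im.
  rewrite swU_pos; try by [lia].
  apply: eq_bigr => p _; rewrite subnn swU_pos0 // bop_U_in.
  by rewrite (bop_U_unit_r (hom_U_in (homog_pr _ p.2))).
have I1 : (I <= m.-1)%N by lia.
rewrite (teq2_bilin (cI I I0 I1) bF) !big_cat /= addr0 leqNgt I0 /= add0r -addrA.
congr (_ + (_ + _)).
- by rewrite big_map big_filter (sum_hD m y (fun j => j <= I)%N (fun j a b => F a (bop (I - j) x b))).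
- rewrite big_flatten big_map /=.
  under eq_bigr => p _ do rewrite big_map big_filter /=.
  rewrite (sum_hD n x xpredT (fun _ a b => \sum_(q <- hD m y | q.1 == I)
    F (bop I a q.2.1) (bop 0 b q.2.2))).
  apply: eq_big_seq => i; rewrite mem_iota => im.
  rewrite swU_pos; try by [lia].
  apply: eq_bigr => p _.
  rewrite (sum_hD m y (fun j => j == I) (fun _ a b =>
    F (bop I (pr i p.1) a) (bop 0 (pr (n - i) p.2) b))).
  rewrite (big_pick (k := I)) ?iota_uniq // => [|j _ /eqP->]; last by rewrite eqxx.
  rewrite mem_iota eqxx andbT ifT; last by lia.
  rewrite swU_pos; try by [lia].
  by apply: eq_bigr => q _; rewrite !bop_U_in.
- by rewrite big_map big_filter (sum_hD m y (fun j => I <= j)%N (fun _ a b => F (bop I x a) b)).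
Qed.

Lemma bilin_vanish_l (W : lmodType K) k l (f : U -> U -> W) d p q :
  bilinear_on hom_U k l f -> hom_U d p -> d != k ->
  f (in_U (pr k p.2)) (in_U (pr l q)) = 0.
Proof.
move=> bf [_ Hp] dk; rewrite (pr_homog k Hp) eq_sym (negbTE dk).
exact: (lin_U0 (bf.1 _ (hom_U_in (homog_pr l q)))).
Qed.

Lemma bilin_pr_id (W : lmodType K) k l (f : U -> U -> W) p q : (0 < k)%N ->
  (0 < l)%N -> hom_U k p -> hom_U l q ->
  f (in_U (pr k p.2)) (in_U (pr l q.2)) = f p q.
Proof.
by move=> k0 l0 Hp Hq; rewrite Hp.2 Hq.2 -(hom_U_pos k0 Hp) -(hom_U_pos l0 Hq).
Qed.

(** The terms of the three sums of [Delta_bop] have left degrees [j <= I], [i + I] with [0 < i < n],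
    and [n + j >= n + I]. These ranges are disjoint, so the projection to left degree [k] leaves one
    term of one sum. *)
Lemma swU_bop (W : lmodType K) k l n m I a a' (f : U -> U -> W) :
  (0 < k)%N -> (0 < l)%N -> (0 < n)%N -> (0 < m)%N -> (I <= m)%N ->
  (k + l = n + m)%N -> homog n a -> homog m a' -> bilinear_on hom_U k l f ->
  swU k l f (bop_U I (in_U a) (in_U a')) =
  if (k <= I)%N then
    swU k (m - k) (fun p q => f p (bop_U (I - k) (in_U a) q)) (in_U a')
  else if (k < n + I)%N then
    swU (k - I) (n + I - k) (fun p q => swU I (m - I) (fun p' q' =>
      f (bop_U I p p') (bop_U 0 q q')) (in_U a')) (in_U a)
  else swU (k - n) (m + n - k) (fun p q => f (bop_U I (in_U a) p) q) (in_U a').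
Proof.
move=> k0 l0 n0 m0 Im klnm Ha Ha' bf.
have Hia := hom_U_in Ha; have Hia' := hom_U_in Ha'.
rewrite swU_pos // bop_U_in.
pose F p q := f (in_U (pr k p)) (in_U (pr l q)).
rewrite (Delta_bop n0 m0 Im Ha Ha' (bilin_in bf)) -/F.
have V1 j : j \in iota 1 m -> (j <= I)%N -> j != k ->
    swU j (m - j) (fun p q => F p.2 (bop_U (I - j) (in_U a) q).2) (in_U a') = 0.
  rewrite mem_iota => jm jI jk; apply: swU_zero => [|p q Hp Hq].
    by rewrite subnKC //; lia.
  exact: bilin_vanish_l bf Hp jk.
have V2 i : i \in iota 1 n.-1 -> i != (k - I)%N ->
    swU i (n - i) (fun p q => swU I (m - I) (fun p' q' =>
     F (bop_U I p p').2 (bop_U 0 q q').2) (in_U a')) (in_U a) = 0.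
  rewrite mem_iota => im ik; apply: swU_zero => [|p q Hp Hq].
    by rewrite subnKC //; lia.
  apply: swU_zero => [|p' q' Hp' Hq']; first by rewrite subnKC.
  have ikI : (i + I)%N != k by apply: contraNneq ik => <-; rewrite addnK.
  exact: bilin_vanish_l bf (hom_bop_U (leqnn I) Hp Hp') ikI.
have V3 j : j \in iota 0 m -> (I <= j)%N -> (n + j)%N != k ->
    swU j (m - j) (fun p q => F (bop_U I (in_U a) p).2 q.2) (in_U a') = 0.
  rewrite mem_iota => jm Ij jk; apply: swU_zero => [|p q Hp Hq].
    by rewrite subnKC //; lia.
  exact: bilin_vanish_l bf (hom_bop_U Ij Hia Hp) jk.
case: (leqP k I) => kI.
  have -> : forall x y z : W, y = 0 -> z = 0 -> x + y + z = x.
    by move=> x y z -> ->; rewrite !addr0.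
  - rewrite (big_pick (k := k)) ?iota_uniq // mem_iota kI ifT; last by lia.
    have Ea' : hom_U (k + (m - k)) (in_U a') by rewrite subnKC //; lia.
    apply: (swU_ext Ea') => p q Hp Hq; apply: bilin_pr_id => //.
    have -> : l = (n + (m - k))%N by lia.
    by apply: hom_bop_U => //; lia.
  - rewrite big_seq big1 // => i ii; apply: V2 => //.
    by move: ii; rewrite mem_iota; lia.
  - rewrite big_seq_cond big1 // => j /andP[jj Ij]; apply: V3 => //.
    by lia.
case: (ltnP k (n + I)) => knI.
  have -> : forall x y z : W, x = 0 -> z = 0 -> x + y + z = y.
    by move=> x y z -> ->; rewrite add0r addr0.
  - rewrite (big_pick (P := xpredT) (k := (k - I)%N)) ?iota_uniq // => [|i ii _]; last exact: V2.
    rewrite mem_iota andbT ifT; last by lia.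
    have -> : (n - (k - I) = n + I - k)%N by lia.
    have Ea : hom_U (k - I + (n + I - k)) (in_U a).
      by have -> : (k - I + (n + I - k) = n)%N by lia.
    apply: (swU_ext Ea) => p q Hp Hq.
    have Ea' : hom_U (I + (m - I)) (in_U a') by rewrite subnKC.
    apply: (swU_ext Ea') => p' q' Hp' Hq'; apply: bilin_pr_id => //.
      by have := hom_bop_U (leqnn I) Hp Hp'; rewrite subnK // ltnW.
    have -> : l = (n + I - k + (m - I))%N by lia.
    exact: hom_bop_U.
  - rewrite big_seq_cond big1 // => j /andP[jj jI]; apply: V1 => //.
    by lia.
  - rewrite big_seq_cond big1 // => j /andP[jj Ij]; apply: V3 => //.
    by lia.
have -> : forall x y z : W, x = 0 -> y = 0 -> x + y + z = z.
  by move=> x y z -> ->; rewrite !add0r.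
- rewrite (big_pick (k := (k - n)%N)) ?iota_uniq // => [|j jj Ij jk]; last first.
    by apply: V3 => //; apply: contraNneq jk => <-; rewrite addKn.
  rewrite mem_iota ifT; last by lia.
  have -> : (m - (k - n) = m + n - k)%N by lia.
  have Ea' : hom_U (k - n + (m + n - k)) (in_U a').
    by have -> : (k - n + (m + n - k) = m)%N by lia.
  apply: (swU_ext Ea') => p q Hp Hq; apply: bilin_pr_id => //.
    have -> : k = (n + (k - n))%N by lia.
    by apply: hom_bop_U; rewrite ?addKn //; lia.
  by have -> : l = (m + n - k)%N by lia.
- rewrite big_seq_cond big1 // => j /andP[jj jI]; apply: V1 => //.
  by lia.
- rewrite big_seq big1 // => i ii; apply: V2 => //.
  by move: ii; rewrite mem_iota; lia.
Qed.

Lemma bop_U_compat_left (W : lmodType K) n k m i (f : U -> U -> W) x y :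
  (i <= m)%N -> hom_U n x -> hom_U (k + m) y -> bilinear_on hom_U k (n + m) f ->
  swU k (n + m) f (bop_U (k + i) x y) = swU k m (fun p q => f p (bop_U i x q)) y.
Proof.
move=> im Hx Hy bf.
case: (posnP k) => [k0|k0].
  by rewrite k0 !swU_0l add0n.
have kim : (k + i <= k + m)%N by rewrite leq_add2l.
case: (hom_U_cases Hx) => [[n0 [c Ex]]|[n0 [a [Ha Ex]]]].
  rewrite Ex (bop_U_scalar_l _ kim Hy) n0 in bf *.
  rewrite (lin_U_scale _ (swU_lin bf) Hy) /sw scaler_sumr.
  apply: eq_big_seq => p /(cop_U_hom Hy)[Hp Hq].
  by rewrite (bop_U_scalar_l _ im Hq) (lin_U_scale _ (bf.2 _ Hp) Hq).
case: (hom_U_cases Hy) => [[km0 _]|[km0 [a' [Ha' Ey]]]]; first by lia.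
case: (posnP m) => [m0|m0].
  move: im; rewrite m0 leqn0 => /eqP->; rewrite m0 !addn0 in bf *.
  rewrite m0 addn0 in Hy Ha' km0.
  rewrite (swU_pos0 _ y) // (bop_U_unit_r Hx) Ex Ey.
  have knk : (k + n = n + k)%N by exact: addnC.
  rewrite (swU_bop (n := n) (m := k)) //.
  rewrite leqnn subnn swU_pos0 // (bop_U_unit_r (hom_U_in Ha)) //.
rewrite Ex Ey (swU_bop (n := n) (m := k + m)) ?addn_gt0 ?n0 ?m0 ?orbT //; last by lia.
by rewrite leq_addr !addKn.
Qed.

Lemma bop_U_compat_right (W : lmodType K) n k m i (f : U -> U -> W) x y :
  (i <= k)%N -> hom_U n x -> hom_U (k + m) y -> bilinear_on hom_U (n + k) m f ->
  swU (n + k) m f (bop_U i x y) = swU k m (fun p q => f (bop_U i x p) q) y.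
Proof.
move=> ik Hx Hy bf.
have ikm : (i <= k + m)%N by apply: leq_trans ik _; apply: leq_addr.
case: (hom_U_cases Hx) => [[n0 [c Ex]]|[n0 [a [Ha Ex]]]].
  rewrite Ex (bop_U_scalar_l _ ikm Hy) n0 add0n in bf *.
  rewrite (lin_U_scale _ (swU_lin bf) Hy) /sw scaler_sumr.
  apply: eq_big_seq => p /(cop_U_hom Hy)[Hp Hq].
  by rewrite (bop_U_scalar_l _ ik Hp) (lin_U_scale _ (bf.1 _ Hq) Hp).
have Hxy := hom_bop_U ikm Hx Hy.
have bg : bilinear_on hom_U k m (fun p q => f (bop_U i x p) q).
  have [bl br] := bop_U_bil n ik.
  split=> [q Hq c p p' Hp Hp' /=|p Hp].
    by rewrite (br _ Hx) // (bf.1 _ Hq) //; apply: hom_bop_U.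
  by apply: bf.2; apply: hom_bop_U.
case: (posnP m) => [m0|m0].
  rewrite m0 addn0 in Hy Hxy bf bg *.
  by rewrite !swU_0r.
case: (hom_U_cases Hy) => [[km0 _]|[km0 [a' [Ha' Ey]]]]; first by lia.
rewrite Ex Ey (swU_bop (n := n) (m := k + m)) ?addn_gt0 ?n0 ?m0 ?orbT //; last by lia.
have -> : (n + k <= i)%N = false by lia.
have -> : (n + k < n + i)%N = false by lia.
by rewrite addKn; have -> : (k + m + n - (n + k) = m)%N by lia.
Qed.

Lemma bop_U_compat_mid (W : lmodType K) k l i m (f : U -> U -> W) x y :
  hom_U (k + l) x -> hom_U (i + m) y -> bilinear_on hom_U (k + i) (l + m) f ->
  swU (k + i) (l + m) f (bop_U i x y) =
  swU k l (fun p q => swU i m (fun p' q' => f (bop_U i p p') (bop_U 0 q q')) y) x.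
Proof.
move=> Hx Hy bf.
(* A cut at an end of x is a cut in y: [k = 0] falls under the left rule and [l = 0] under the right
   one. *)
case: (posnP k) => [k0|k0].
  rewrite k0 !add0n in Hx bf *.
  rewrite swU_0l -{2}[i]addn0 bop_U_compat_left //; apply: (swU_ext Hy) => p q Hp Hq.
  by rewrite (bop_U_unit_l _ Hp).
case: (posnP l) => [l0|l0].
  rewrite l0 !add0n addn0 in Hx bf *.
  rewrite swU_pos0 // bop_U_compat_right //; apply: (swU_ext Hy) => p q Hp Hq.
  by rewrite (bop_U_unit_l _ Hq).
case: (hom_U_cases Hx) => [[kl0 _]|[kl0 [a [Ha Ex]]]]; first by lia.
case: (hom_U_cases Hy) => [[im0 [c Ey]]|[im0 [a' [Ha' Ey]]]].
  have [i0 m0] : i = 0%N /\ m = 0%N by lia.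
  rewrite i0 m0 !addn0 in Hy bf *.
  rewrite Ey (bop_U_scalar_r _ Hx) (lin_U_scale _ (swU_lin bf) Hx) scaler_sumr.
  apply: eq_big_seq => p /(cop_U_hom Hx)[Hp Hq].
  rewrite swU_0l (bop_U_unit_r Hp) (bop_U_scalar_r _ Hq).
  by rewrite (lin_U_scale _ (bf.2 _ Hp) Hq).
have ki0 : (0 < k + i)%N by lia.
have lm0 : (0 < l + m)%N by lia.
rewrite Ex Ey (swU_bop (n := k + l) (m := i + m)) ?leq_addr //; last by lia.
have -> : (k + i <= i)%N = false by lia.
have -> : (k + i < k + l + i)%N by lia.
by rewrite addnK addKn; have -> : (k + l + i - (k + i) = l)%N by lia.
Qed.

Lemma bop_U_assoc n m r i j x y z : (i <= m)%N -> (j <= r)%N ->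
  hom_U n x -> hom_U m y -> hom_U r z ->
  bop_U j (bop_U i x y) z = bop_U (i + j)%N x (bop_U j y z).
Proof.
move=> im jr Hx Hy Hz; have Hyz := hom_bop_U jr Hy Hz.
have ijmr : (i + j <= m + r)%N by apply: leq_add.
have Hx' := Hx; have Hy' := Hy.
case: (hom_U_cases Hx) => [[n0 [c Ex]]|[n0 [a [Ha Ex]]]].
  rewrite Ex (bop_U_scalar_l _ im Hy) (bop_U_scalar_l _ ijmr Hyz).
  by rewrite (lin_U_scale _ ((bop_U_bil m jr).1 _ Hz) Hy).
case: (hom_U_cases Hy) => [[m0 [c Ey]]|[m0 [a' [Ha' Ey]]]].
  move: im; rewrite m0 leqn0 => /eqP->.
  rewrite Ey (bop_U_scalar_r _ Hx) (bop_U_scalar_l _ jr Hz) add0n.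
  rewrite (lin_U_scale _ ((bop_U_bil n jr).1 _ Hz) Hx).
  by rewrite (lin_U_scale _ ((bop_U_bil n jr).2 _ Hx) Hz).
case: (hom_U_cases Hz) => [[r0 [c Ez]]|[r0 [a'' [Ha'' Ez]]]].
  move: jr; rewrite r0 leqn0 => /eqP->.
  rewrite Ez (bop_U_scalar_r _ (hom_bop_U im Hx Hy)) (bop_U_scalar_r _ Hy) addn0.
  by rewrite (lin_U_scale _ ((bop_U_bil n im).2 _ Hx) Hy).
rewrite Ex Ey Ez !bop_U_in; congr in_U.
by case: gbA => [[[_ pa] _ _ _] _]; apply: (pa n m r).
Qed.

Lemma bop_U_graft n m r i j x y z : (i < j)%N -> (j <= r)%N ->
  hom_U n x -> hom_U m y -> hom_U r z ->
  bop_U i x (bop_U j y z) = bop_U (j + n)%N y (bop_U i x z).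
Proof.
move=> ij jr Hx Hy Hz.
have ir : (i <= r)%N by lia.
have imr : (i <= m + r)%N by lia.
have jnnr : (j + n <= n + r)%N by lia.
case: (hom_U_cases Hz) => [[r0 _]|[r0 [a'' [Ha'' Ez]]]]; first by lia.
case: (hom_U_cases Hx) => [[n0 [c Ex]]|[n0 [a [Ha Ex]]]].
  rewrite Ex (bop_U_scalar_l _ imr (hom_bop_U jr Hy Hz)) (bop_U_scalar_l _ ir Hz).
  by rewrite n0 addn0 (lin_U_scale _ ((bop_U_bil m jr).2 _ Hy) Hz).
case: (hom_U_cases Hy) => [[m0 [c Ey]]|[m0 [a' [Ha' Ey]]]].
  rewrite Ey (bop_U_scalar_l _ jr Hz) (bop_U_scalar_l _ jnnr (hom_bop_U ir Hx Hz)).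
  by rewrite (lin_U_scale _ ((bop_U_bil n ir).2 _ Hx) Hz).
rewrite Ex Ey Ez !bop_U_in; congr in_U.
by case: gbA => _ ga; apply: (ga n m r).
Qed.

Lemma unitized_grafting : unital_grafting hom_U unit_U bop_U cop_U.
Proof.
split.
- exact: hom_U_zero.
- exact: hom_U_lin.
- exact: hom_U_one.
- exact: hom_bop_U.
- exact: bop_U_bil.
- exact: bop_U_unit_l.
- exact: bop_U_unit_r.
- exact: bop_U_assoc.
- exact: bop_U_graft.
- exact: cop_U_hom.
- exact: swU_lin.
- exact: swU_coassoc.
- by move=> W n f x _ _; apply: swU_0l.
- exact: swU_0r.
- exact: bop_U_compat_left.
- exact: bop_U_compat_mid.
- exact: bop_U_compat_right.
Qed.

End Unitization.

(** * Shuffles and words *)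

Definition typ n (g : seq nat) : seq bool := [seq (j <= n)%N | j <- g].

(** Standardization of a two-letter word: with the starting values 1 and [n.+1] it inverts [typ n]
    on shuffles. *)
Fixpoint decode a b (v : seq bool) : seq nat :=
  match v with
  | [::] => [::]
  | true :: v' => a :: decode a.+1 b v'
  | false :: v' => b :: decode a b.+1 v'
  end.

Lemma map_index_uniq (T : eqType) (s : seq T) : uniq s ->
  map (index^~ s) s = iota 0 (size s).
Proof.
case: s => // x s' us; set s := x :: s'.
apply: (@eq_from_nth _ 0%N) => [|i]; rewrite size_map ?size_iota // => ilt.
by rewrite (nth_map x) // index_uniq // nth_iota.
Qed.

Lemma sorted_index (T : eqType) (s : seq T) : uniq s ->
  sorted (relpre (index^~ s) ltn) s.
Proof. by move=> us; rewrite -sorted_map map_index_uniq // iota_ltn_sorted. Qed.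

Lemma sorted_index_iotaP (g : seq nat) c k :
  reflect (forall a, (c <= a)%N -> (a.+1 < c + k)%N -> (index a g < index a.+1 g)%N)
    (sorted (relpre (index^~ g) ltn) (iota c k)).
Proof.
apply: (iffP (sortedP 0%N)) => h.
  move=> a ca ack; have := h (a - c)%N; rewrite size_iota.
  rewrite !nth_iota; [|lia|lia].
  by rewrite addnS subnKC //; apply; lia.
move=> i; rewrite size_iota => ik; rewrite !nth_iota; [|lia|lia].
by rewrite addnS; apply: h; lia.
Qed.

(** Both the filtered word and the interval of values are sorted strictly by position in [g] and
    have the same elements, hence they coincide. The index conditions are thereby traded for
    filters, which fit induction on words. *)
Lemma shuffleP n m g : is_shuffle n m g <->
  [seq j <- g | (j <= n)%N] = iota 1 n /\ [seq j <- g | (n < j)%N] = iota n.+1 m.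
Proof.
have ltT : transitive (relpre (index^~ g) ltn) by move=> y x z; apply: ltn_trans.
have ltI : irreflexive (relpre (index^~ g) ltn) by move=> x /=; rewrite ltnn.
split=> [[pg h1 h2]|[f1 f2]].
  have ug : uniq g by rewrite (perm_uniq pg) iota_uniq.
  split; apply: (irr_sorted_eq ltT ltI).
  - exact/sorted_filter/sorted_index.
  - apply/sorted_index_iotaP => a a0 an; apply: h1 => //; lia.
  - by move=> j; rewrite mem_filter (perm_mem pg) !mem_iota; lia.
  - exact/sorted_filter/sorted_index.
  - apply/sorted_index_iotaP => a a0 an; apply: h2 => //; lia.
  - by move=> j; rewrite mem_filter (perm_mem pg) !mem_iota; lia.
have pg : perm_eq g (iota 1 (n + m)).
  rewrite iotaD add1n -f1 -f2 perm_sym.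
  rewrite (eq_filter (a1 := fun j => (n < j)%N) (a2 := predC (fun j => j <= n)%N)).
    by rewrite perm_filterC.
  by move=> j /=; rewrite ltnNge.
have ug : uniq g by rewrite (perm_uniq pg) iota_uniq.
have sg := sorted_index ug.
split=> // a a0 an.
  have := sorted_filter ltT (fun j => j <= n)%N sg.
  by rewrite f1 => /sorted_index_iotaP; apply; lia.
have := sorted_filter ltT (fun j => n < j)%N sg.
by rewrite f2 => /sorted_index_iotaP; apply; lia.
Qed.

Lemma mem_shuffle n m g j : is_shuffle n m g -> (j \in g) = (0 < j <= n + m)%N.
Proof. by case=> /perm_mem-> _ _; rewrite mem_iota add1n ltnS. Qed.

Lemma size_shuffle n m g : is_shuffle n m g -> size g = (n + m)%N.
Proof. by case=> /perm_size-> _ _; rewrite size_iota. Qed.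

Lemma trues_typ n m g : is_shuffle n m g -> trues (typ n g) = n.
Proof. by case/shuffleP=> f1 _; rewrite trues_map -size_filter f1 size_iota. Qed.

Lemma falses_typ n m g : is_shuffle n m g -> falses (typ n g) = m.
Proof.
move=> sg; have := trues_falses (typ n g).
rewrite (trues_typ sg) size_map (size_shuffle sg); exact: addnI.
Qed.

Lemma decode_map (p : pred nat) g a b k l :
  filter p g = iota a k -> filter (predC p) g = iota b l ->
  g = decode a b (map p g).
Proof.
elim: g a b k l => //= j g IHg a b k l; case: (p j) => /=.
  by case: k => // k [-> f1] f2; rewrite -(IHg a.+1 b k l).
by case: l => // l f1 [-> f2]; rewrite -(IHg a b.+1 k l).
Qed.

Lemma shuffle_decode n m g : is_shuffle n m g -> g = decode 1 n.+1 (typ n g).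
Proof.
case/shuffleP=> f1 f2; apply: (decode_map f1 (l := m)); rewrite -f2.
by apply: eq_filter => j /=; rewrite ltnNge.
Qed.

Lemma size_decode a b v : size (decode a b v) = size v.
Proof. by elim: v a b => [|[] v IHv] a b //=; rewrite IHv. Qed.

Lemma decode_cat a b v1 v2 : decode a b (v1 ++ v2) =
  decode a b v1 ++ decode (a + trues v1) (b + falses v1) v2.
Proof.
rewrite /trues /falses; elim: v1 a b => [|[] v1 IHv] a b /=.
- by rewrite !addn0.
- by rewrite IHv add0n add1n addSnnS.
- by rewrite IHv add0n add1n addSnnS.
Qed.

Lemma map_decode (p : pred nat) a b v :
  (forall i, (i < trues v)%N -> p (a + i)%N) ->
  (forall i, (i < falses v)%N -> ~~ p (b + i)%N) ->
  map p (decode a b v) = v.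
Proof.
rewrite /trues /falses; elim: v a b => [|[] v IHv] a b //= h1 h2.
  have := h1 0%N; rewrite addn0 => -> //; congr (_ :: _); apply: IHv => // i ilt.
  by rewrite addSnnS; apply: h1; rewrite add1n ltnS.
have := h2 0%N; rewrite addn0 => /(_ isT) /negbTE->; congr (_ :: _).
apply: IHv => // i ilt.
by rewrite addSnnS; apply: h2; rewrite add1n ltnS.
Qed.

Lemma map_decode_shift (f : nat -> nat) a b a' b' v :
  (forall i, (i < trues v)%N -> f (a + i)%N = (a' + i)%N) ->
  (forall i, (i < falses v)%N -> f (b + i)%N = (b' + i)%N) ->
  map f (decode a b v) = decode a' b' v.
Proof.
rewrite /trues /falses; elim: v a b a' b' => [|[] v IHv] a b a' b' //= h1 h2.
  have := h1 0%N; rewrite !addn0 => ->; last by [].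
  congr (_ :: _); apply: IHv => // i ilt.
  by rewrite !addSnnS; apply: h1; rewrite add1n ltnS.
have := h2 0%N; rewrite !addn0 => ->; last by [].
congr (_ :: _); apply: IHv => // i ilt.
by rewrite !addSnnS; apply: h2; rewrite add1n ltnS.
Qed.

Lemma filter_decode (p : pred nat) a b v :
  (forall i, (i < trues v)%N -> p (a + i)%N) ->
  (forall i, (i < falses v)%N -> ~~ p (b + i)%N) ->
  filter p (decode a b v) = iota a (trues v) /\
  filter (predC p) (decode a b v) = iota b (falses v).
Proof.
rewrite /trues /falses; elim: v a b => [|[] v IHv] a b //= h1 h2.
  have h1' i : (i < count id v)%N -> p (a.+1 + i)%N.
    by move=> ilt; rewrite addSnnS; apply: h1; rewrite add1n ltnS.
  have := h1 0%N; rewrite addn0 => -> //=.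
  by have [-> ->] := IHv _ _ h1' h2.
have h2' i : (i < count negb v)%N -> ~~ p (b.+1 + i)%N.
  by move=> ilt; rewrite addSnnS; apply: h2; rewrite add1n ltnS.
have := h2 0%N; rewrite addn0 => /(_ isT) /negbTE-> /=.
by have [-> ->] := IHv _ _ h1 h2'.
Qed.

Lemma decode_shuffle v : is_shuffle (trues v) (falses v) (decode 1 (trues v).+1 v).
Proof.
have [|i _|f1 f2] := @filter_decode (fun j => j <= trues v)%N 1 (trues v).+1 v.
- by move=> i; rewrite add1n.
- by rewrite -ltnNge ltnS leq_addr.
apply/shuffleP; split=> //; rewrite -f2.
by apply: eq_filter => j /=; rewrite ltnNge.
Qed.

Lemma map_addr_iota a k c : [seq (j + c)%N | j <- iota a k] = iota (a + c) k.
Proof. by rewrite addnC iotaDl; apply: eq_map => j; rewrite addnC. Qed.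

(** * Decomposition of a shuffle at a cut *)

Definition exch n1 n2 m1 m2 : seq nat :=
  prodw (prodw (idw n1) (epsw n2 m1)) (idw m2).

(** The [m1] upper values of the left half rise by [n2] to make room for the [n2] lower values of
    the right half, which come down by [m1]. *)
Lemma nth_exch n1 n2 m1 m2 j : (0 < j <= n1 + m1 + (n2 + m2))%N ->
  nth 0%N (exch n1 n2 m1 m2) j.-1 =
  if (j <= n1)%N then j else
  if (j <= n1 + m1)%N then (j + n2)%N else
  if (j <= n1 + m1 + n2)%N then (j - m1)%N else j.
Proof.
rewrite /exch /prodw /epsw /idw map_cat !map_addr_iota size_cat size_iota.
rewrite size_cat !size_iota !nth_cat !size_cat !size_iota => /andP[j0 jle].
case: (leqP j n1) => j1.
  rewrite !ifT; try by [lia].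
  by rewrite nth_iota; lia.
case: (leqP j (n1 + m1)) => j2.
  rewrite ifT; last by lia.
  rewrite ifF; last by lia.
  rewrite ifT; last by lia.
  by rewrite nth_iota; lia.
case: (leqP j (n1 + m1 + n2)) => j3.
  rewrite ifT; last by lia.
  rewrite ifF; last by lia.
  rewrite ifF; last by lia.
  by rewrite nth_iota; lia.
rewrite ifF; last by lia.
by rewrite nth_iota; lia.
Qed.

(** The pair is chosen by [epsilon], so a witness is exhibited first; the type words of the chosen
    pair are then read off its defining equation. *)
Lemma shuffle_decompP n m g r : is_shuffle n m g -> (r <= n + m)%N ->
  let v := typ n g in
  let n1 := dec_n1 n g r in
  let p := shuffle_decomp n m g r in
  [/\ n1 = trues (take r v), (r - n1)%N = falses (take r v),
      (n - n1)%N = trues (drop r v), (m - (r - n1))%N = falses (drop r v) &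
      [/\ is_shuffle n1 (r - n1) p.1, is_shuffle (n - n1) (m - (r - n1)) p.2,
       typ n1 p.1 = take r v & typ (n - n1) p.2 = drop r v]].
Proof.
move=> sg rnm v n1 p; set m1 := (r - n1)%N.
have En1 : n1 = trues (take r v) by rewrite /n1 /dec_n1 -map_take trues_map.
have szv : size v = (n + m)%N by rewrite size_map (size_shuffle sg).
have szt : size (take r v) = r.
  by rewrite size_take szv; case: ltngtP rnm.
have Em1 : m1 = falses (take r v).
  by rewrite /m1 En1 -{1}szt -trues_falses addKn.
have tv : (trues (take r v) + trues (drop r v) = n)%N.
  by rewrite -(trues_typ sg) -/v -{3}(cat_take_drop r v) /trues count_cat.
have fv : (falses (take r v) + falses (drop r v) = m)%N.
  by rewrite -(falses_typ sg) -/v -{3}(cat_take_drop r v) /falses count_cat.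
have En2 : (n - n1)%N = trues (drop r v) by rewrite En1; lia.
have Em2 : (m - m1)%N = falses (drop r v) by rewrite Em1; lia.
have nm1 : (n1 + m1 = r)%N by rewrite En1 Em1 trues_falses.
pose Q (q : seq nat * seq nat) := [/\ is_shuffle n1 m1 q.1,
    is_shuffle (n - n1) (m - m1) q.2 &
    g = compw (exch n1 (n - n1) m1 (m - m1)) (prodw q.1 q.2)].
have [s1 s2 Eg] : Q p.
  apply: (@epsilon_spec _ (inhabits ([::], [::])) Q).
  (* Witness: the standardizations of the two halves of the type word of [g]. *)
  exists (decode 1 n1.+1 (take r v), decode 1 (n - n1).+1 (drop r v)); split.
  - by rewrite [in X in is_shuffle X]En1 Em1 En1; apply: decode_shuffle.
  - by rewrite En2 Em2; apply: decode_shuffle.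
  pose rho j := nth 0%N (exch n1 (n - n1) m1 (m - m1)) j.-1.
  have rhoE j : (0 < j <= n1 + m1 + (n - n1 + (m - m1)))%N -> rho j =
      if (j <= n1)%N then j else if (j <= n1 + m1)%N then (j + (n - n1))%N else
      if (j <= n1 + m1 + (n - n1))%N then (j - m1)%N else j by exact: nth_exch.
  rewrite /compw -/rho /prodw map_cat -map_comp [LHS](shuffle_decode sg) -/v.
  rewrite -[in LHS](cat_take_drop r v) decode_cat /= size_decode szt; congr (_ ++ _).
    symmetry; apply: (map_decode_shift (f := rho)) => i; rewrite -?En1 -?Em1 => ilt.
      rewrite rhoE; last by lia.
      by rewrite ifT; lia.
    rewrite rhoE; last by lia.
    rewrite ifF; last by lia.
    by rewrite ifT; lia.
  rewrite -En1 -Em1.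
  have h1 i : (i < trues (drop r v))%N -> rho (1 + i + r)%N = (1 + n1 + i)%N.
    rewrite -En2 => ilt; rewrite rhoE; last by lia.
    rewrite ifF; last by lia.
    rewrite ifF; last by lia.
    by rewrite ifT; lia.
  have h2 i : (i < falses (drop r v))%N ->
      rho ((n - n1).+1 + i + r)%N = (n.+1 + m1 + i)%N.
    rewrite -Em2 => ilt; rewrite rhoE; last by lia.
    rewrite ifF; last by lia.
    rewrite ifF; last by lia.
    by rewrite ifF; lia.
  by rewrite -(map_decode_shift (f := fun j => rho (j + r)%N) h1 h2).
have szp : size p.1 = r by rewrite (size_shuffle s1).
(* Renaming by [exch] sends the lower values of each half to values at most [n] and the upper ones
   beyond [n], so the equation for [g] determines both type words. *)
have Ev : v = typ n1 p.1 ++ typ (n - n1) p.2.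
  rewrite /v /typ [in LHS]Eg /compw /prodw !map_cat -!map_comp szp; congr (_ ++ _).
    apply/eq_in_map => j; rewrite (mem_shuffle _ s1) => jb /=.
    rewrite nth_exch; last by lia.
    case: (leqP j n1) => j1; first by lia.
    by rewrite ifT; lia.
  apply/eq_in_map => j; rewrite (mem_shuffle _ s2) => jb /=.
  rewrite nth_exch; last by lia.
  rewrite ifF; last by lia.
  rewrite ifF; last by lia.
  by case: (leqP _ (n1 + m1 + (n - n1))) => j1; lia.
have szt1 : size (typ n1 p.1) = r by rewrite size_map.
by split=> //; split=> //; rewrite Ev -szt1 ?take_size_cat ?drop_size_cat.
Qed.

Lemma nth_pred_iota (T : Type) (x : T) s :
  [seq nth x s j.-1 | j <- iota 1 (size s)] = s.
Proof.
by rewrite -[1%N]addn0 iotaDl -map_comp -[RHS](mkseq_nth x).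
Qed.

(** The common value [u] of the two composites is the three-letter word: values up to [n] stand for
    x, the next [m] for y, the last [r] for z. Each of the four shuffles arises from [u] by merging
    two letters or by deleting one, as [word_assoc] expects. *)
Lemma shuffle_assoc_words n m r g d s l : is_shuffle n (m + r) g ->
  is_shuffle m r d -> is_shuffle n m s -> is_shuffle (n + m) r l ->
  compw (prodw (idw n) d) g = compw (prodw s (idw r)) l ->
  let u := compw (prodw (idw n) d) g in
  let X := fun j => (j <= n)%N in
  let P := fun j => (j <= n + m)%N in
  [/\ map X u = typ n g, map P (filter (predC X) u) = typ m d,
      map X (filter P u) = typ n s & map P u = typ (n + m) l].
Proof.
move=> sg sd ss sl E u X P.
have szd := size_shuffle sd; have szs := size_shuffle ss.
have ng j : (0 < j <= n + (m + r))%N -> nth 0%N (prodw (idw n) d) j.-1 =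
    if (j <= n)%N then j else (nth 0%N d (j - n).-1 + n)%N.
  move=> jb; rewrite /prodw /idw nth_cat size_iota.
  case: (leqP j n) => jn; first by rewrite ifT ?nth_iota; lia.
  rewrite ifF; last by lia.
  rewrite (nth_map 0%N); last by lia.
  by congr (nth _ _ _ + _)%N; lia.
have nl j : (0 < j <= n + m + r)%N -> nth 0%N (prodw s (idw r)) j.-1 =
    if (j <= n + m)%N then nth 0%N s j.-1 else j.
  move=> jb; rewrite /prodw /idw nth_cat szs.
  case: (leqP j (n + m)) => jn; first by rewrite ifT; lia.
  rewrite ifF; last by lia.
  by rewrite map_addr_iota nth_iota; lia.
have d0 j : (n < j <= n + (m + r))%N -> (0 < nth 0%N d (j - n).-1)%N.
  move=> jb; have : nth 0%N d (j - n).-1 \in d by apply: mem_nth; rewrite szd; lia.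
  by rewrite (mem_shuffle _ sd) => /andP[].
have sle j : (0 < j <= n + m)%N -> (nth 0%N s j.-1 <= n + m)%N.
  move=> jb; have : nth 0%N s j.-1 \in s by apply: mem_nth; rewrite szs; lia.
  by rewrite (mem_shuffle _ ss) => /andP[].
have Xg : {in g, forall j, X (nth 0%N (prodw (idw n) d) j.-1) = (j <= n)%N}.
  move=> j; rewrite (mem_shuffle _ sg) => jb; rewrite ng // /X.
  by case: (leqP j n) => [//|jn]; have := d0 j; lia.
have Pl : {in l, forall j, P (nth 0%N (prodw s (idw r)) j.-1) = (j <= n + m)%N}.
  move=> j; rewrite (mem_shuffle _ sl) => jb; rewrite nl // /P.
  by case: (leqP j (n + m)) => [jn|]; [rewrite sle | ]; lia.
have [_ fg] := (shuffleP _ _ _).1 sg; have [fl _] := (shuffleP _ _ _).1 sl.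
have fd : filter (predC X) u = [seq (j + n)%N | j <- d].
  rewrite /u /compw filter_map.
  rewrite (eq_in_filter (a2 := fun j => (n < j)%N)) => [|j jg]; last first.
    by rewrite /= Xg // ltnNge.
  rewrite fg -[in RHS](nth_pred_iota 0%N d) szd -map_comp.
  rewrite -[n.+1]add1n -map_addr_iota -map_comp; apply/eq_in_map => j.
  rewrite mem_iota => jb /=; rewrite ng; last by lia.
  rewrite ifF; last by lia.
  by congr (nth _ _ _ + _)%N; lia.
have fs : filter P u = s.
  rewrite /u E /compw filter_map.
  rewrite (eq_in_filter (a2 := fun j => (j <= n + m)%N)) => [|j jl]; last exact: Pl.
  rewrite fl -[RHS](nth_pred_iota 0%N s) szs; apply/eq_in_map => j.
  rewrite mem_iota => jb; rewrite nl; last by lia.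
  by rewrite ifT; lia.
split.
- by rewrite /u /compw /typ -map_comp; apply/eq_in_map.
- rewrite fd -map_comp; apply: eq_map => j /=.
  by rewrite /P addnC leq_add2l.
- by rewrite fs.
- by rewrite /u E /compw /typ -map_comp; apply/eq_in_map.
Qed.

(** * Compositions of a shuffle and gaps of its word *)

Fixpoint blocks_word (ns ms : seq nat) : seq bool :=
  match ns, ms with
  | n1 :: ns', m1 :: ms' => nseq m1 false ++ nseq n1 true ++ blocks_word ns' ms'
  | [::], [:: m1] => nseq m1 false
  | _, _ => [::]
  end.

Lemma decode_falses a b k : decode a b (nseq k false) = iota b k.
Proof. by elim: k b => //= k IHk b; rewrite IHk. Qed.

Lemma decode_trues a b k : decode a b (nseq k true) = iota a k.
Proof. by elim: k a => //= k IHk a; rewrite IHk. Qed.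

Lemma trues_nseq (c : bool) k : trues (nseq k c) = (c * k)%N.
Proof. exact: count_nseq. Qed.

Lemma falses_nseq (c : bool) k : falses (nseq k c) = (~~ c * k)%N.
Proof. exact: count_nseq. Qed.

Lemma blocksw_decode a b ns ms : size ms = (size ns).+1 ->
  blocksw a b ns ms = decode a b (blocks_word ns ms).
Proof.
elim: ns ms a b => [|n1 ns IHn] [|m1 ms] a b //= [].
  by move/size0nil->; rewrite decode_falses.
move=> sz; rewrite !decode_cat decode_falses decode_trues IHn //.
by rewrite !trues_nseq !falses_nseq !mul0n !mul1n !addn0.
Qed.

Lemma trues_blocks_word ns ms : size ms = (size ns).+1 ->
  trues (blocks_word ns ms) = sumn ns /\ falses (blocks_word ns ms) = sumn ms.
Proof.
elim: ns ms => [|n1 ns IHn] [|m1 ms] //= [].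
  by move/size0nil->; rewrite trues_nseq falses_nseq mul1n addn0.
move=> /IHn[t f]; rewrite /trues /falses !count_cat -/trues -/falses.
by rewrite -!/(trues _) -!/(falses _) t f !trues_nseq !falses_nseq !mul0n !mul1n add0n.
Qed.

Definition inner_pos (ns ms : seq nat) : Prop :=
  forall j, (0 < j)%N -> (j < size ns)%N -> (0 < nth 0%N ms j)%N.

(** A letter put in front either lengthens the first run of its kind or opens a new block. The empty
    word has the single run [[:: 0]], the last and possibly empty m-part. *)
Lemma blocks_word_ex v : exists ns ms, [/\ size ms = (size ns).+1,
  all (fun k => 0 < k)%N ns, inner_pos ns ms & v = blocks_word ns ms].
Proof.
elim: v => [|c v [ns [ms [sz an im ->]]]]; first by exists [::], [:: 0%N].
case: ms sz im => [//|m1 ms] sz im; case: c; last first.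
  exists ns, (m1.+1 :: ms); split=> //; first by case=> // j; apply: (im j.+1).
  by case: (ns) sz => [|n1 ns'] //; case: (ms).
case: ns an sz im => [|n1 ns] an sz im.
  exists [:: 1%N], [:: 0%N, m1 & ms]; split=> //; first by move: sz => /= [->].
  by case=> // j.
case: m1 sz im => [|m1] sz im.
  have /andP[_ an'] := an; by exists (n1.+1 :: ns), (0%N :: ms); split=> //.
exists [:: 1%N, n1 & ns], [:: 0%N, m1.+1 & ms]; split=> //=; first by move: sz => /= [->].
by case=> // -[|j] _ jn //; apply: (im j.+1).
Qed.

Lemma shuffle_compsP n m g : is_shuffle n m g ->
  let c := shuffle_comps n m g in
  [/\ size c.2 = (size c.1).+1, sumn c.1 = n, sumn c.2 = m &
    [/\ all (fun k => 0 < k)%N c.1, inner_pos c.1 c.2 & typ n g = blocks_word c.1 c.2]].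
Proof.
move=> sg c.
pose Q (q : seq nat * seq nat) := [/\ size q.2 = (size q.1).+1, sumn q.1 = n,
    sumn q.2 = m & [/\ all (fun k => 0 < k)%N q.1, inner_pos q.1 q.2 &
     g = blocksw 1 n.+1 q.1 q.2]].
have [sz s1 s2 [an im Eg]] : Q c.
  apply: (@epsilon_spec _ (inhabits ([::], [::])) Q).
  have [ns [ms [sz an im Ev]]] := blocks_word_ex (typ n g).
  have [t f] := trues_blocks_word sz.
  exists (ns, ms); rewrite /Q /= blocksw_decode // -t -f -Ev (trues_typ sg) (falses_typ sg).
  by split=> //; split=> //; apply: shuffle_decode sg.
split=> //; split=> //; rewrite [in LHS]Eg blocksw_decode //.
have [t _] := trues_blocks_word sz.
apply: map_decode => i ilt; first by rewrite add1n -s1 -t.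
by rewrite -ltnNge ltnS leq_addr.
Qed.

(** For [acc = 0], the pairs formed by the partial sum of the first j m-parts and the j-th n-part:
    indices and degrees of the operators in the nested product. The last m-part gives no pair
    because no x follows it. *)
Fixpoint comp_blocks acc (ns ms : seq nat) : seq (nat * nat) :=
  match ns, ms with
  | n1 :: ns', m1 :: ms' => (acc + m1, n1)%N :: comp_blocks (acc + m1)%N ns' ms'
  | _, _ => [::]
  end.

Lemma deg_comp_blocks acc ns ms : size ms = (size ns).+1 ->
  deg (comp_blocks acc ns ms) = sumn ns.
Proof.
elim: ns ms acc => [|n1 ns IHn] [|m1 ms] acc //= [sz].
by rewrite deg_cons IHn.
Qed.

Lemma idx_le_comp_blocks N acc ns ms : (acc + sumn ms <= N)%N ->
  idx_le N (comp_blocks acc ns ms).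
Proof.
elim: ns ms acc => [|n1 ns IHn] [|m1 ms] acc //= h.
apply/andP; split; first by rewrite /=; lia.
by apply: IHn; rewrite -addnA.
Qed.

Local Notation nonzero_blocks := (filter (fun p : nat * nat => p.2 != 0%N)).

Lemma blocks_falses a k j v : nonzero_blocks (blocks a k (nseq j.+1 false ++ v)) =
  nonzero_blocks ((a, k) :: blocks (a + j.+1) 0 v).
Proof.
elim: j a k => [|j IHj] a k; first by rewrite addn1.
rewrite -[LHS]/(nonzero_blocks ([:: (a, k)] ++ blocks a.+1 0 (nseq j.+1 false ++ v))).
by rewrite filter_cat IHj -filter_cat addSnnS /=.
Qed.

Lemma blocks_trues a k j v : blocks a k (nseq j true ++ v) = blocks a (k + j) v.
Proof. by elim: j k => [|j IHj] k; rewrite ?addn0 //= IHj addSnnS. Qed.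

(** A run of several y's only adds empty gaps to the gap list. The last condition excludes a pending
    run of [k] x's followed directly by further x's, which would merge into one gap on the left and
    stay two blocks on the right. *)
Lemma blocks_of_comps a k ns ms : size ms = (size ns).+1 -> inner_pos ns ms ->
  k = 0%N \/ ns = [::] \/ (0 < head 0 ms)%N ->
  nonzero_blocks (blocks a k (blocks_word ns ms)) =
  nonzero_blocks ((a, k) :: comp_blocks a ns ms).
Proof.
elim: ns ms a k => [|n1 ns IHn] [|m1 ms] a k // [sz] im hk.
  rewrite (size0nil sz) [blocks_word _ _]/=; case: m1 {im hk} => [//|j].
  by rewrite -[nseq _ _]cats0 blocks_falses.
have im' : inner_pos ns ms by move=> j j0 jn; apply: (im j.+1).
have hk' : n1 = 0%N \/ ns = [::] \/ (0 < head 0%N ms)%N.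
  right; case: (ns) im => [|n2 ns'] im'2; [by left | right].
  by have := im'2 1%N isT isT; case: (ms).
case: m1 im hk => [|m1] im hk.
  have -> : k = 0%N by case: hk => [|[|]].
  by rewrite [blocks_word _ _]/= blocks_trues IHn //= addn0.
by rewrite [blocks_word _ _]/= -cat_cons -/(nseq m1.+1 false) blocks_falses /= blocks_trues IHn.
Qed.

(** * Return from the unitization to A *)

Section Transfer.
Variables (K : fieldType) (A : lmodType K) (pr : nat -> A -> A).
Variables (bop : nat -> A -> A -> A) (Delta : A -> seq (A * A)).
Hypotheses (grA : graded pr) (gbA : grafting_bialgebra pr Delta bop).

Let ug := unitized_grafting grA gbA.
Local Notation homog := (homog pr).
Local Notation sop := (graft_sop pr Delta bop).
Local Notation hom_U := (hom_U pr).
Local Notation b_U := (bop_U bop).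
Local Notation c_U := (cop_U pr Delta).
Local Notation swU := (sw c_U).
Local Notation wordU := (word b_U c_U).
Local Notation convU := (conv b_U c_U).
Local Notation one_U := (unit_U A).

Lemma size_iterD k x l : l \in Defs.iterD Delta k x -> size l = k.+1.
Proof.
elim: k x l => [|k IHk] x l /=; first by rewrite inE => /eqP->.
by case/flatten_mapP=> p _ /mapP[l' /IHk sl' ->] /=; rewrite sl'.
Qed.

Local Notation proj_on ns l := [seq pr q.1 q.2 | q <- zip ns l].

Lemma homog_nest ns l ms acc y N : size l = size ns -> size ms = (size ns).+1 ->
  (acc + sumn ms <= N)%N -> homog N y ->
  homog (sumn ns + N) (nest bop (proj_on ns l) ms acc y).
Proof.
move=> + + + Hy; elim: ns l ms acc => [|n1 ns IHn] [|x l] [|m1 ms] acc //= [sl] [sm] h.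
have h' : (acc + m1 + sumn ms <= N)%N by lia.
have im : (acc + m1 <= sumn ns + N)%N by lia.
rewrite -addnA.
by have [] := bop_spec gbA im (homog_pr grA n1 x) (IHn l ms _ sl sm h').
Qed.

(** [iterD] iterates the bare coproduct on the right factor and projects only at the end, while
    [conv] works degree by degree; at each level [Delta_pr] inserts the missing projection. *)
Lemma sum_nest (ns ms : seq nat) acc x y N : ns != [::] -> all (fun k => 0 < k)%N ns ->
  size ms = (size ns).+1 -> (acc + sumn ms <= N)%N -> homog N y ->
  in_U (\sum_(l <- Defs.iterD Delta (size ns).-1 x)
    nest bop (proj_on ns l) ms acc y) =
  convU (comp_blocks acc ns ms) (in_U (pr (sumn ns) x)) (in_U y).
Proof.
move=> + + + + Hy; elim: ns ms acc x => [//|n1 ns IHn] [//|m1 ms] acc x _.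
move=> /andP[n10 nspos] [sz] /= h.
have Hyu := hom_U_in Hy.
have h' : (acc + m1 + sumn ms <= N)%N by lia.
case: ns => [|n2 ns] in IHn nspos sz *.
  rewrite /= addn0 big_seq1 /= (ug_counitr ug).
  - by rewrite (ug_1b ug (m := N)) // bop_U_in.
  - by apply: (@bil_b_conv _ _ _ _ _ _ ug (acc + m1)%N n1 N [::]) => //; rewrite add0n; lia.
  - exact/hom_U_in/homog_pr.
set ns' := n2 :: ns in IHn nspos sz *.
have ns'0 : (0 < sumn ns')%N by move: nspos => /= /andP[]; lia.
have dc := deg_comp_blocks (acc + m1) sz.
have cN := @idx_le_comp_blocks N (acc + m1) ns' ms h'.
have im : (acc + m1 <= sumn ns' + N)%N by lia.
rewrite dc swU_pos //.
have bb := @bil_b_conv _ _ _ _ _ _ ug (acc + m1)%N n1 N _ _ cN _ Hyu.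
rewrite dc in bb; have {}bb := bilin_in grA (bb im).
rewrite (Delta_pr grA gbA (f := fun u v => b_U (acc + m1) (in_U u)
  (convU (comp_blocks (acc + m1) ns' ms) (in_U v) (in_U y)))) //.
rewrite big_flatten big_map /= (linear_map_sum _ _ (@in_U_lin _ _)).
apply: eq_bigr => p _; rewrite big_map /=.
rewrite -IHn // !(linear_map_sum _ _ (@in_U_lin _ _)).
have Hp := hom_U_in (homog_pr grA n1 p.1).
rewrite (linear_on_sum ug (linear_on_br ug im Hp)).
  by apply: eq_bigr => l _; rewrite bop_U_in.
by move=> l /size_iterD sl; apply: hom_U_in; apply: homog_nest.
Qed.

(** The nested product is the convolution over [comp_blocks], and this list agrees with the gap list
    of the word once empty blocks are dropped. *)
Lemma graft_word n m g x y : is_shuffle n m g -> homog n x -> homog m y ->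
  in_U (sop n m g x y) = wordU (typ n g) (in_U x) (in_U y).
Proof.
move=> sg Hx Hy; rewrite /graft_sop.
have := shuffle_compsP sg; set c := shuffle_comps n m g.
case: c => ns ms /= [sz sn sm [an im Ev]].
have [Hxu Hyu] := (hom_U_in Hx, hom_U_in Hy).
have [tg fg] := (trues_typ sg, falses_typ sg).
(* An empty composition means [n = 0]: [graft_sop] takes its default value 0, which is right because
   x is then 0. *)
case: ns => [|n1 ns] in sz sn an im Ev *.
  have n0 : n = 0%N by [].
  have x0 : x = 0 by apply: (homog_deg0 gbA); rewrite -n0.
  have := (word_bil ug (typ n g)).1 (in_U y).
  rewrite tg fg => /(_ Hyu) wl.
  by rewrite x0 -[in RHS](erefl : 0 = in_U 0) (linear_on0 ug wl).
set ns' := n1 :: ns in sz sn an im Ev *.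
rewrite (@sum_nest ns' ms 0 x y m) //; last by rewrite sm.
rewrite sn Hx /word -[blocks _ _ _]cat0s.
have cm : idx_le m (comp_blocks 0 ns' ms) by apply: idx_le_comp_blocks; rewrite sm.
have bm : idx_le m (blocks 0 0 (typ n g)) by apply: idx_le_blocks; rewrite fg.
have db : deg (blocks 0 0 (typ n g)) = n by rewrite deg_blocks0.
have dc : deg (comp_blocks 0 ns' ms) = n by rewrite deg_comp_blocks.
rewrite (conv_filter ug (m := m) (s1 := [::])) //; last by rewrite db.
rewrite -[comp_blocks _ _ _]cat0s (conv_filter ug (m := m) (s1 := [::])) //; last by rewrite dc.
by rewrite Ev (blocks_of_comps 0 sz im) //; left.
Qed.

Lemma hom_word_graft n m g x y : is_shuffle n m g -> homog n x -> homog m y ->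
  homog (n + m) (sop n m g x y).
Proof.
move=> sg Hx Hy; suff [] : hom_U (n + m) (in_U (sop n m g x y)) by [].
rewrite (graft_word sg Hx Hy) -(size_shuffle sg) -(size_map (fun j => j <= n)%N g).
by apply: (hom_word ug); rewrite ?(trues_typ sg) ?(falses_typ sg); apply: hom_U_in.
Qed.

Lemma in_U_inj : injective (@in_U K A).
Proof. by move=> a a' []. Qed.

Lemma graft_sop_ok : sop_ok pr sop.
Proof.
move=> n m g sg x y Hx Hy; split; first exact: hom_word_graft.
  move=> k x' Hx'; apply: in_U_inj.
  have Hkx := homog_lin grA k Hx Hx'.
  rewrite in_U_lin !graft_word // in_U_lin.
  have := (word_bil ug (typ n g)).1 (in_U y).
  by rewrite (trues_typ sg) (falses_typ sg); apply; apply: hom_U_in.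
move=> k y' Hy'; apply: in_U_inj.
have Hky := homog_lin grA k Hy Hy'.
rewrite in_U_lin !graft_word // in_U_lin.
have := (word_bil ug (typ n g)).2 (in_U x).
by rewrite (trues_typ sg) (falses_typ sg); apply; apply: hom_U_in.
Qed.

Lemma graft_shuffle_algebra : shuffle_algebra pr sop.
Proof.
split=> [|n m r g d s l x y z Hx Hy Hz sg sd ss sl E]; first exact: graft_sop_ok.
have Hyz := hom_word_graft sd Hy Hz; have Hxy := hom_word_graft ss Hx Hy.
apply: in_U_inj; rewrite !graft_word //.
have [] := shuffle_assoc_words sg sd ss sl E.
set u := compw _ _; set X := fun j => (j <= n)%N; set P := fun j => (j <= n + m)%N.
move=> Eg Ed Es El.
have XP : subpred X P by move=> j jn; apply: leq_trans jn (leq_addr _ _).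
have cX : count X u = n by rewrite -(trues_typ sg) -Eg trues_map.
have cY : count (predI P (predC X)) u = m.
  by rewrite -(trues_typ sd) -Ed trues_PX.
have cZ : count (predC P) u = r.
  by rewrite -(falses_typ sl) -El falses_map.
rewrite -Eg -Ed -Es -El /word; symmetry.
apply: (word_assoc ug XP (r := r)); rewrite ?cX ?cY ?cZ //; exact: hom_U_in.
Qed.

Definition emb_U (u : option A) : unitized A :=
  if u is Some a then in_U a else one_U.

Definition opt_homog n (u : option A) : Prop :=
  if u is Some a then homog n a else n = 0%N.

(** The conventions for 1 are the unit laws of [word]. Two units give the value 0 of [uop], which is
    the A-component of the unit. *)
Lemma uop_word n m g u v : is_shuffle n m g -> opt_homog n u -> opt_homog m v ->
  uop sop n m g u v = (wordU (typ n g) (emb_U u) (emb_U v)).2.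
Proof.
move=> sg Hu Hv.
have [tg fg] := (trues_typ sg, falses_typ sg).
case: u v Hu Hv => [a|] [a'|] Hu Hv.
- by rewrite -(graft_word sg Hu Hv).
- by rewrite (word_unit_r ug) ?fg ?tg //; apply: hom_U_in.
- by rewrite (word_unit_l ug) ?fg ?tg //; apply: hom_U_in.
- rewrite (word_unit_l ug) ?fg ?tg //; rewrite Hv; exact: hom_U_one.
Qed.

Lemma mem_DPlus n k x u : (k <= n)%N -> homog n x -> u \in DPlus pr Delta n k x ->
  opt_homog k u.1 /\ opt_homog (n - k) u.2.
Proof.
move=> kn Hx; rewrite /DPlus; case: eqP => [->|k0]; last case: eqP => [->|kn'].
- by rewrite inE subn0 => /eqP->.
- by rewrite inE subnn => /eqP->.
case/mapP=> q; rewrite mem_filter => /andP[/eqP qk].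
case/flatten_mapP=> j _ /mapP[p _ Eq] ->; rewrite -qk Eq /=.
by split; apply: homog_pr.
Qed.

Lemma sum_DPlus (W : lmodType K) n k x (G : unitized A -> unitized A -> W) :
  (k <= n)%N -> \sum_(u <- DPlus pr Delta n k x) G (emb_U u.1) (emb_U u.2) =
  swU k (n - k) G (in_U x).
Proof.
move=> kn; rewrite /DPlus; case: (posnP k) => [->|k0].
  by rewrite /= big_seq1 swU_0l.
case: (eqVneq k n) => [->|kn'].
  by rewrite ?eqxx /= big_seq1 subnn swU_pos0 // (leq_trans k0).
have nk0 : (0 < n - k)%N by rewrite subn_gt0 ltn_neqAle kn'.
rewrite big_map big_filter (sum_hD pr Delta n x (fun j => j == k) (fun _ a b => G (in_U a) (in_U b))).
rewrite (big_pick (k := k)) ?iota_uniq // => [|j _ /eqP->]; last by rewrite eqxx.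
by rewrite eqxx andbT mem_iota ifT ?swU_pos //; lia.
Qed.

Lemma graft_shuffle_compat : shuffle_compat pr Delta sop.
Proof.
move=> n m g x y sg Hx Hy W f fl; rewrite !big_map.
pose F a b := f [:: a; b].
have bF : bilin F.
  split=> c a a' b; first by apply: (fl [::] [:: b]).
  by apply: (fl [:: a] [::]).
have Hz := hom_word_graft sg Hx Hy.
(* The degree of the left tensor factor is the position of the cut, so the two outer sums are
   compared term by term. *)
rewrite (Delta_graded grA gbA bF Hz) big_flatten big_map.
apply: eq_big_seq => r; rewrite mem_iota => rb.
have rnm : (r <= n + m)%N by lia.
have := shuffle_decompP sg rnm; rewrite /=.
set n1 := dec_n1 n g r; set m1 := (r - n1)%N; set p := shuffle_decomp n m g r.
set v := typ n g => -[En1 Em1 En2 Em2 [s1 s2 Et1 Et2]].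
have n1n : (n1 <= n)%N by rewrite -(trues_typ sg) -/v -(cat_take_drop r v) /trues count_cat -/(trues _) -En1 leq_addr.
have m1m : (m1 <= m)%N by rewrite -(falses_typ sg) -/v -(cat_take_drop r v) /falses count_cat -/(falses _) -Em1 leq_addr.
have szv : size v = (n + m)%N by rewrite size_map (size_shuffle sg).
have szt : size (take r v) = r by rewrite size_take szv; case: ltngtP rnm.
have szd : size (drop r v) = (n + m - r)%N by rewrite size_drop szv.
(* [F] is extended to the unitization by forgetting scalar parts, in line with the A-components in
   [uop_word]. *)
pose G (u w : unitized A) := F u.2 w.2.
have bG k l : bilinear_on hom_U k l G.
  by split=> w _ c u u' _ _; [apply: bF.1 | apply: bF.2].
transitivity (swU r (n + m - r) G (in_U (sop n m g x y))).
  rewrite swU_pos; [|by lia|by lia].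
  apply: eq_bigr => q _; by [].
rewrite (graft_word sg Hx Hy) -/v -{1}(cat_take_drop r v) -{1}szt -szd.
rewrite (word_cut ug) -?En1 -?Em1 -?En2 -?Em2 ?subnKC //.
rewrite -(sum_DPlus _ _ n1n) big_flatten big_map; apply: eq_big_seq => u /(mem_DPlus n1n Hx)[Hu1 Hu2].
rewrite -(sum_DPlus _ _ m1m) big_map; apply: eq_big_seq => w /(mem_DPlus m1m Hy)[Hw1 Hw2].
rewrite (uop_word s1 Hu1 Hw1) (uop_word s2 Hu2 Hw2) Et1 Et2.
by [].
Qed.

End Transfer.

Theorem mainTheorem17 (K : fieldType) (A : lmodType K) (pr : nat -> A -> A)
  (bop : nat -> A -> A -> A) (Delta : A -> seq (A * A)) :
  graded pr -> grafting_bialgebra pr Delta bop ->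
  shuffle_bialgebra pr Delta (graft_sop pr Delta bop).
Proof.
move=> grA gbA; have [[_ A0 co _] _] := gbA; split=> //.
- exact: graft_shuffle_algebra.
- exact: graft_shuffle_compat.
Qed.
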